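(* Every nonnegative integer $n$ can be written as $p_5(w)+2p_5(x)+3p_5(y)+4p_5(z)$ with $w,x,y,z$ nonnegative integers.
   Context: For $k\in\mathbb{Z}$, $p_5(k)=k(3k-1)/2$ (pentagonal numbers when $k\ge 0$). *)

(* Defs.v *)
From mathcomp Require Import all_boot.
(* Generalized pentagonal numbers p_5(k) = k(3k-1)/2, here for nonnegative k
   (natural numbers). For k = 0, 3*0-1 truncates to 0, giving 0 as required;
   for k >= 1, 3k-1 is exact. k(3k-1) is always even, so ./2 is exact. *)
Definition p5 (k : nat) : nat := (k * (3 * k - 1))./2.

(* Main.v *)
From Stdlib Require Import ZArith Lia List Permutation Classical ClassicalEpsilon Znumtheory MSetPositive.
Require Import Defs.
From mathcomp Require Import all_boot.

(** The substitution [w + 2x + 3y + 4z = 2b], [w^2 + 2x^2 + 3y^2 + 4z^2 = 2a], with [n = 3a - b],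
    turns the problem into representing [5a - b^2] by [t^2 + 2u^2 + 3v^2] with congruences modulo 5;
    if [b] is close enough to its maximal value, [w, x, y, z] are automatically nonnegative.
    There are admissible [b] for which [5a - b^2] is odd or four times an odd number, so that the
    ternary form is reached from the theorem that twice an odd number is a sum of three squares.

    The three-squares theorem is obtained without Dirichlet's theorem, in the manner of Kronecker.
    For odd [m] let [r m] count the solutions of [e^2 + o^2 + o'^2 = 2m] with [e] even, and let [h m]
    count the triples [(a, c, T)] with [a c - 2 T^2 = m] and [2 |T| < min a c]. For every odd [N] the
    sum over all integers [K] of [r (N - 2 K^2)] is four times the sum of divisors of [N], by Jacobi's
    two-squares theorem and an elementary identity of Dirichlet, while the sum of [h (N - 2 K^2)] is
    the sum of divisors of [N], because every sublattice of index [N] of [Z^2] has exactly one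
    reduced basis. Hence [r m = 4 h m], and [h m > 0] because of [(1, m, 0)]. *)

Set Bullet Behavior "Strict Subproofs".
Local Open Scope Z_scope.
Local Open Scope list_scope.
Import ListNotations.
Ltac Zify.zify_post_hook ::= Z.to_euclidean_division_equations.

(** * Finite sums *)

(** Nonnegativity of [w, x, y, z] asks for [b] at least about [sqrt (3n/2)], and positivity of
    [5a - b^2] for [b] below about [sqrt (5n/3)]: an interval of length about [0.066 sqrt n]. In it
    one needs a [b] from a prescribed class modulo 48, where 3 makes [a] an integer and 16 controls
    [5a - b^2], and this [b] must not be a multiple of 5. Hence the large threshold for [n]; the
    smaller numbers are settled by a computation that takes [z] almost as large as possible. The two
    sums over [K] determine [r] and [h] because only [K = 0] involves [N] itself. The hard half of
    the lattice count is uniqueness: two reduced bases of one lattice coincide. *)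

Definition lsum {A : Type} (w : A -> Z) (l : list A) : Z :=
  fold_right (fun x s => w x + s) 0 l.

Definition finite {A : Type} (P : A -> Prop) : Prop :=
  exists l : list A, forall x, P x -> In x l.

(** Choosing an enumeration by [epsilon] makes sums and cardinalities total functions of the
    predicate; by [wsum_enum] the choice does not affect the value. *)
Definition enum_of {A : Type} (P : A -> Prop) : list A :=
  epsilon (inhabits nil) (fun l => NoDup l /\ forall x, In x l <-> P x).

(* [wsum P w] is the sum of [w] over the set [P]; it is meaningful only for finite [P]. *)
Definition wsum {A : Type} (P : A -> Prop) (w : A -> Z) : Z := lsum w (enum_of P).

Definition setcard {A : Type} (P : A -> Prop) : Z := wsum P (fun _ => 1).

Lemma finite_enum {A : Type} (P : A -> Prop) :
  finite P -> exists l, NoDup l /\ forall x, In x l <-> P x.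
Proof.
intros [l Hl].
pose (d := fun x y : A => excluded_middle_informative (x = y)).
exists (nodup d (List.filter (fun x => if excluded_middle_informative (P x) then true else false) l)).
split; [apply NoDup_nodup|].
intros x; rewrite nodup_In filter_In.
destruct (excluded_middle_informative (P x)) as [H|H]; split; intuition; try discriminate.
Qed.

Lemma enum_ofP {A : Type} (P : A -> Prop) :
  finite P -> NoDup (enum_of P) /\ forall x, In x (enum_of P) <-> P x.
Proof.
intros H; apply (epsilon_spec (inhabits nil) (fun l => NoDup l /\ forall x, In x l <-> P x)).
now apply finite_enum.
Qed.

Lemma finite_sub {A : Type} (P Q : A -> Prop) :
  finite Q -> (forall x, P x -> Q x) -> finite P.
Proof. intros [l Hl] H; exists l; auto. Qed.

Lemma finite_prod {A B : Type} (P : A -> Prop) (Q : B -> Prop) :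
  finite P -> finite Q -> finite (fun z => P (fst z) /\ Q (snd z)).
Proof.
intros [l Hl] [m Hm]; exists (list_prod l m).
intros [x y] [Hx Hy]; apply in_prod; auto.
Qed.

Lemma finite_Z (P : Z -> Prop) (n : Z) : (forall x, P x -> - n <= x <= n) -> finite P.
Proof.
intros H; exists (map (fun k => Z.of_nat k - n) (List.seq 0 (Z.to_nat (2 * n + 1)))).
intros x Hx; specialize (H x Hx); apply in_map_iff; exists (Z.to_nat (x + n)).
split; [lia|apply in_seq; lia].
Qed.

Lemma finite_Z2 (P : Z * Z -> Prop) (n : Z) :
  (forall x y, P (x, y) -> - n <= x <= n /\ - n <= y <= n) -> finite P.
Proof.
intros H.
apply (finite_sub _ _ (finite_prod _ _ (finite_Z (fun x => -n <= x <= n) n (fun x h => h))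
                                   (finite_Z (fun x => -n <= x <= n) n (fun x h => h)))).
intros [x y] h; exact (H x y h).
Qed.

Lemma finite_Z3 (P : Z * Z * Z -> Prop) (n : Z) :
  (forall x y z, P (x, y, z) -> - n <= x <= n /\ - n <= y <= n /\ - n <= z <= n) -> finite P.
Proof.
intros H.
apply (finite_sub _ _ (finite_prod _ _ (finite_Z2 (fun t => -n <= fst t <= n /\ -n <= snd t <= n) n
   (fun x y h => h)) (finite_Z (fun x => -n <= x <= n) n (fun x h => h)))).
intros [[x y] z] h; specialize (H x y z h); simpl; tauto.
Qed.

Lemma finite_Z4 (P : Z * Z * Z * Z -> Prop) (n : Z) :
  (forall x y z t, P (x, y, z, t) ->
    - n <= x <= n /\ - n <= y <= n /\ - n <= z <= n /\ - n <= t <= n) -> finite P.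
Proof.
intros H.
apply (finite_sub _ _ (finite_prod _ _
  (finite_Z3 (fun t => let '(x, y, z) := t in -n <= x <= n /\ -n <= y <= n /\ -n <= z <= n) n
   (fun x y z h => h)) (finite_Z (fun x => -n <= x <= n) n (fun x h => h)))).
intros [[[x y] z] t] h; specialize (H x y z t h); simpl; tauto.
Qed.

Lemma lsum_perm {A : Type} (w : A -> Z) l l' : Permutation l l' -> lsum w l = lsum w l'.
Proof. induction 1; simpl; lia. Qed.

Lemma lsum_app {A : Type} (w : A -> Z) l l' : lsum w (l ++ l') = lsum w l + lsum w l'.
Proof. induction l; simpl; lia. Qed.

Lemma lsum_map {A B : Type} (f : A -> B) (w : B -> Z) l :
  lsum w (map f l) = lsum (fun x => w (f x)) l.
Proof. induction l; simpl; lia. Qed.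

Lemma lsum_ext {A : Type} (w w' : A -> Z) l :
  (forall x, In x l -> w x = w' x) -> lsum w l = lsum w' l.
Proof.
induction l as [|x l IH]; simpl; intros H; [reflexivity|].
rewrite (H x) ?IH; auto.
Qed.

Lemma wsum_enum {A : Type} (P : A -> Prop) w l :
  NoDup l -> (forall x, In x l <-> P x) -> wsum P w = lsum w l.
Proof.
intros Hl HP.
destruct (enum_ofP P) as [H1 H2]; [exists l; intros x; apply HP|].
apply lsum_perm, NoDup_Permutation; auto.
intros x; rewrite H2 HP; tauto.
Qed.

Lemma wsum_bij {A B : Type} (P : A -> Prop) (Q : B -> Prop) (f : A -> B) (g : B -> A)
    (w : A -> Z) (w' : B -> Z) :
  finite P ->
  (forall x, P x -> Q (f x) /\ g (f x) = x /\ w x = w' (f x)) ->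
  (forall y, Q y -> P (g y) /\ f (g y) = y) ->
  wsum P w = wsum Q w'.
Proof.
intros HP Hf Hg.
destruct (enum_ofP P HP) as [N1 N2].
rewrite (wsum_enum Q w' (map f (enum_of P))).
- rewrite lsum_map; apply lsum_ext; intros x Hx; apply Hf, N2, Hx.
- apply NoDup_map_NoDup_ForallPairs; [|exact N1].
  intros x y Hx Hy E; apply N2 in Hx; apply N2 in Hy.
  destruct (Hf x Hx) as [_ [<- _]], (Hf y Hy) as [_ [<- _]]; now rewrite E.
- intros y; rewrite in_map_iff; split.
  + intros [x [<- Hx]]; apply Hf, N2, Hx.
  + intros Hy; destruct (Hg y Hy) as [H1 H2]; exists (g y); split; [exact H2|now apply N2].
Qed.

Lemma wsum_ext {A : Type} (P Q : A -> Prop) w w' :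
  finite P -> (forall x, P x <-> Q x) -> (forall x, P x -> w x = w' x) -> wsum P w = wsum Q w'.
Proof.
intros HP HPQ Hw; apply (wsum_bij P Q id id); auto.
- intros x Hx; repeat split; [now apply HPQ|now apply Hw].
- intros y Hy; split; [now apply HPQ|reflexivity].
Qed.

Lemma wsum_split {A : Type} (P P1 P2 : A -> Prop) w :
  finite P -> (forall x, P x <-> P1 x \/ P2 x) -> (forall x, P1 x -> P2 x -> False) ->
  wsum P w = wsum P1 w + wsum P2 w.
Proof.
intros HP H Hd.
destruct (enum_ofP P1) as [A1 A2]; [apply (finite_sub _ P HP); firstorder|].
destruct (enum_ofP P2) as [B1 B2]; [apply (finite_sub _ P HP); firstorder|].
rewrite (wsum_enum P w (enum_of P1 ++ enum_of P2)).
- apply lsum_app.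
- apply NoDup_app; auto; intros x Hx Hy; apply (Hd x); [now apply A2|now apply B2].
- intros x; rewrite in_app_iff A2 B2 H; tauto.
Qed.

Lemma lsum_lin {A : Type} (w w' : A -> Z) a b l :
  lsum (fun x => a * w x + b * w' x) l = a * lsum w l + b * lsum w' l.
Proof. induction l; simpl; lia. Qed.

Lemma wsum_lin {A : Type} (P : A -> Prop) (w w' : A -> Z) a b :
  wsum P (fun x => a * w x + b * w' x) = a * wsum P w + b * wsum P w'.
Proof. apply lsum_lin. Qed.

Lemma wsum_scale {A : Type} (P : A -> Prop) (w : A -> Z) a :
  wsum P (fun x => a * w x) = a * wsum P w.
Proof.
unfold wsum; induction (enum_of P); simpl; lia.
Qed.

Lemma wsum_empty {A : Type} (P : A -> Prop) w : (forall x, ~ P x) -> wsum P w = 0.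
Proof.
intros H; rewrite (wsum_enum P w nil); [reflexivity|constructor|].
intros x; split; [intros []|intros Hx; now destruct (H x)].
Qed.

Lemma wsum_single {A : Type} (P : A -> Prop) w x : (forall y, P y <-> y = x) -> wsum P w = w x.
Proof.
intros H; rewrite (wsum_enum P w [x]); [simpl; lia|repeat constructor; intros []|].
intros y; rewrite H; simpl; intuition.
Qed.

Lemma setcard_length {A : Type} (P : A -> Prop) : setcard P = Z.of_nat (List.length (enum_of P)).
Proof.
unfold setcard, wsum; induction (enum_of P) as [|x l IH]; [reflexivity|].
change (1 + lsum (fun _ => 1) l = Z.of_nat (S (List.length l))); lia.
Qed.

Lemma setcard_pos {A : Type} (P : A -> Prop) x : finite P -> P x -> 0 < setcard P.
Proof.
intros HP Hx; rewrite setcard_length; apply (enum_ofP P HP) in Hx.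
destruct (enum_of P) as [|y l]; [destruct Hx|].
change (0 < Z.of_nat (S (List.length l))); lia.
Qed.

Lemma setcard_inhabited {A : Type} (P : A -> Prop) : 0 < setcard P -> exists x, P x.
Proof.
intros H; apply NNPP; intros N.
unfold setcard in H; rewrite wsum_empty in H; [lia|]; intros x Hx; apply N; now exists x.
Qed.

(** Applied in both directions, this replaces an explicit bijection between reduced bases and
    Hermite normal forms. *)
Lemma setcard_le_rel {A B : Type} (P : A -> Prop) (Q : B -> Prop) (R : A -> B -> Prop) :
  finite P -> finite Q ->
  (forall x, P x -> exists y, Q y /\ R x y) ->
  (forall x x' y, P x -> P x' -> Q y -> R x y -> R x' y -> x = x') ->
  setcard P <= setcard Q.
Proof.
intros HP HQ Hex Hinj.
destruct (enum_ofP P HP) as [P1 P2], (enum_ofP Q HQ) as [Q1 Q2].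
rewrite !setcard_length; apply inj_le.
destruct (classic (exists y, Q y)) as [[y0 _]|Hn].
- pose (f := fun x => epsilon (inhabits y0) (fun y => Q y /\ R x y)).
  assert (Hf : forall x, P x -> Q (f x) /\ R x (f x)).
  { intros x Hx; apply (epsilon_spec (inhabits y0) (fun y => Q y /\ R x y)); auto. }
  rewrite <- (length_map f (enum_of P)).
  apply NoDup_incl_length.
  + apply NoDup_map_NoDup_ForallPairs; [|exact P1].
    intros x x' Hx Hx' E; apply P2 in Hx; apply P2 in Hx'.
    apply (Hinj x x' (f x)); auto; try apply Hf; auto.
    rewrite E; now apply Hf.
  + intros y; rewrite in_map_iff; intros [x [<- Hx]]; apply Q2, Hf, P2, Hx.
- destruct (enum_of P) as [|x l] eqn:E; [simpl; lia|].
  destruct (Hex x) as [y [Hy _]]; [apply P2; left; reflexivity|].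
  destruct Hn; now exists y.
Qed.

Lemma wsum_fibre {A B : Type} (P : A -> Prop) (K : B -> Prop) (k : A -> B) (w : A -> Z) :
  finite P -> finite K -> (forall x, P x -> K (k x)) ->
  wsum P w = wsum K (fun b => wsum (fun x => P x /\ k x = b) w).
Proof.
intros HP HK Hk.
destruct (enum_ofP K HK) as [K1 K2].
assert (H : forall l, NoDup l -> wsum (fun x => P x /\ In (k x) l) w
            = lsum (fun b => wsum (fun x => P x /\ k x = b) w) l).
{ induction l as [|b l IH]; intros Hl.
  - apply wsum_empty; intros x [_ []].
  - inversion Hl; subst; simpl lsum; rewrite -IH; auto.
    apply wsum_split.
    + apply (finite_sub _ P HP); tauto.
    + intros x; simpl; intuition.
    + intros x [_ <-] [_ H]; auto. }
unfold wsum at 2; rewrite -H; auto.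
apply wsum_ext; auto.
intros x; rewrite K2; intuition.
Qed.

Lemma wsum_prod {A B : Type} (P : A -> Prop) (Q : B -> Prop) (w : A -> Z) (w' : B -> Z) :
  finite P -> finite Q ->
  wsum (fun z => P (fst z) /\ Q (snd z)) (fun z => w (fst z) * w' (snd z)) = wsum P w * wsum Q w'.
Proof.
intros HP HQ; pose proof (finite_prod _ _ HP HQ) as HPQ.
rewrite (wsum_fibre _ P fst); auto; [|tauto].
rewrite Z.mul_comm -wsum_scale; apply wsum_ext; auto; [tauto|].
intros x Hx; rewrite Z.mul_comm -wsum_scale.
apply (wsum_bij _ _ snd (fun y => (x, y))).
- apply (finite_sub _ _ HPQ); tauto.
- intros [a b]; simpl; intros [[H1 H2] <-]; auto.
- intros y Hy; simpl; auto.
Qed.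

(** * Sublattices and reduced bases *)

(* [reduced (a, c, u, v)] : the rows [(a, u)] and [(-2v, c)] form a reduced basis. *)
Definition reduced (a c u v : Z) : Prop :=
  0 < a /\ 0 < c /\ (u - v) mod 2 = 0 /\ - a < u - v < a /\ - c < u - v < c.

(* The lattice spanned by the rows [(x, z)] and [(w, y)] contains the basis [(a, u)], [(-2v, c)]. *)
Definition basis_of (x z w y a c u v : Z) : Prop :=
  exists al be ga de, al * de - be * ga = 1 /\
    a = al * x + be * w /\ u = al * z + be * y /\ -2 * v = ga * x + de * w /\ c = ga * z + de * y.

Definition has_reduced (x z w y : Z) : Prop :=
  exists a c u v, reduced a c u v /\ basis_of x z w y a c u v.

Lemma has_reduced_change x z w y p q r s : p * s - q * r = 1 ->
  has_reduced (p * x + q * w) (p * z + q * y) (r * x + s * w) (r * z + s * y) ->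
  has_reduced x z w y.
Proof.
intros H (a & c & u & v & Hr & al & be & ga & de & H1 & -> & -> & Hv & ->).
do 4 eexists; split; [exact Hr|].
exists (al * p + be * r), (al * q + be * s), (ga * p + de * r), (ga * q + de * s).
repeat split; try ring; [|rewrite Hv; ring].
transitivity ((al * de - be * ga) * (p * s - q * r)); [ring|rewrite H1 H; ring].
Qed.

(** The lattice is reflected in a coordinate axis and one row is negated to keep the orientation; a
    reduced basis then has [u] and [v] negated. *)
Lemma has_reduced_reflect x z w y : has_reduced x (- z) (- w) y -> has_reduced x z w y.
Proof.
intros (a & c & u & v & Hr & al & be & ga & de & H1 & -> & -> & Hv & ->).
exists (al * x + be * - w), (ga * - z + de * y), (- (al * - z + be * y)), (- v); split.
- unfold reduced in *; revert Hr; generalize (al * - z + be * y); intros u Hr.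
  lia.
- exists al, (- be), (- ga), de; repeat split; lia.
Qed.

Lemma has_reduced_id a c u v : reduced a c u v -> has_reduced a u (-2 * v) c.
Proof.
intros H; exists a, c, u, v; split; [exact H|].
exists 1, 0, 0, 1; repeat split; ring.
Qed.

(* Stepping through the bases with [(a, u)] in the first and [(-2v, c)] in the second quadrant,
   [u - v] increases; a reduced basis is found where it changes sign. *)
Lemma has_reduced_nonneg (n : nat) : forall a c u v,
  0 < a -> 0 < c -> 0 <= u <= v -> a mod 2 = 1 -> c mod 2 = 1 -> v - u <= Z.of_nat n ->
  has_reduced a u (-2 * v) c.
Proof.
induction n as [|n IH]; intros a c u v Ha Hc Huv Hao Hco Hn.
{ apply has_reduced_id; unfold reduced; repeat split; lia. }
destruct (Z.eq_dec u v) as [E|E].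
{ apply has_reduced_id; unfold reduced; repeat split; lia. }
(* With rows [R1, R2], the next basis is [R1, 2 R1 + R2] if [a <= v], then [R1 + R2, R2] if
   [2v < a], and otherwise [-(R1 + R2), 2 R1 + R2] after a reflection. Each move strictly lowers
   [v - u]. *)
destruct (Z_le_gt_dec a v) as [Hav|Hav].
- destruct (Z_le_gt_dec (u + a) v) as [Hs|Hs].
  + apply (has_reduced_change _ _ _ _ 1 0 2 1); [ring|].
    pose proof (IH a (c + 2 * u) u (v - a)) as H.
    replace (1 * a + 0 * (-2 * v)) with a by ring.
    replace (1 * u + 0 * c) with u by ring.
    replace (2 * a + 1 * (-2 * v)) with (-2 * (v - a)) by ring.
    replace (2 * u + 1 * c) with (c + 2 * u) by ring.
    apply H; lia.
  (* The sign changes here. As [a] is odd, exactly one of [u - v] and [u - (v - a)] is even; if it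
     is [u - v] but [c] is too small, [-(R1 + R2), 2 R1 + R2] is reduced. *)
  + destruct (Z.eq_dec ((u - v) mod 2) 0) as [He|He].
    * destruct (Z_lt_ge_dec (v - u) c) as [Hvc|Hvc].
      { apply has_reduced_id; unfold reduced; repeat split; lia. }
      exists (2 * v - a), (c + 2 * u), (- (u + c)), (v - a); split.
      { unfold reduced; repeat split; lia. }
      exists (-1), (-1), 2, 1; repeat split; ring.
    * exists a, (c + 2 * u), u, (v - a); split.
      { unfold reduced; repeat split; lia. }
      exists 1, 0, 2, 1; repeat split; ring.
- destruct (Z_lt_ge_dec (2 * v) a) as [Hva|Hva].
  + destruct (Z_le_gt_dec (u + c) v) as [Hs|Hs].
    * apply (has_reduced_change _ _ _ _ 1 1 0 1); [ring|].
      pose proof (IH (a - 2 * v) c (u + c) v) as H.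
      replace (1 * a + 1 * (-2 * v)) with (a - 2 * v) by ring.
      replace (1 * u + 1 * c) with (u + c) by ring.
      replace (0 * a + 1 * (-2 * v)) with (-2 * v) by ring.
      replace (0 * u + 1 * c) with c by ring.
      apply H; lia.
    * destruct (Z.eq_dec ((u - v) mod 2) 0) as [He|He].
      { apply has_reduced_id; unfold reduced; repeat split; lia. }
      destruct (Z_lt_ge_dec (u + v + c) a) as [Hb|Hb].
      { exists (a - 2 * v), c, (u + c), v; split.
        - unfold reduced; repeat split; lia.
        - exists 1, 1, 0, 1; repeat split; ring. }
      exists a, (c + 2 * u), u, (v - a); split.
      { unfold reduced; repeat split; lia. }
      exists 1, 0, 2, 1; repeat split; ring.
  + destruct (Z_le_gt_dec (u + v + c) a) as [Hs|Hs].
    * apply (has_reduced_change _ _ _ _ (-1) (-1) 2 1); [ring|].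
      apply has_reduced_reflect.
      pose proof (IH (2 * v - a) (c + 2 * u) (u + c) (a - v)) as H.
      replace (-1 * a + -1 * (-2 * v)) with (2 * v - a) by ring.
      replace (- (-1 * u + -1 * c)) with (u + c) by ring.
      replace (- (2 * a + 1 * (-2 * v))) with (-2 * (a - v)) by ring.
      replace (2 * u + 1 * c) with (c + 2 * u) by ring.
      apply H; lia.
    * destruct (Z.eq_dec ((u - v) mod 2) 0) as [He|He].
      { destruct (Z_lt_ge_dec (v - u) c) as [Hvc|Hvc].
        { apply has_reduced_id; unfold reduced; repeat split; lia. }
        exists (2 * v - a), (c + 2 * u), (- (u + c)), (v - a); split.
        { unfold reduced; repeat split; lia. }
        exists (-1), (-1), 2, 1; repeat split; ring. }
      exists a, (c + 2 * u), u, (v - a); split.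
      { unfold reduced; repeat split; lia. }
      exists 1, 0, 2, 1; repeat split; ring.
Qed.

Lemma has_reduced_hermite g w y :
  0 < g -> 0 < y -> (g * y) mod 2 = 1 -> 0 <= w < g -> has_reduced g 0 (- w) y.
Proof.
intros Hg Hy Ho Hw.
assert (Hgo : g mod 2 = 1 /\ y mod 2 = 1).
{ rewrite Zmult_mod in Ho.
  pose proof (Z.mod_pos_bound g 2); pose proof (Z.mod_pos_bound y 2).
  assert (g mod 2 = 0 \/ g mod 2 = 1) as [E|E] by lia; rewrite E in Ho; [discriminate|].
  assert (y mod 2 = 0 \/ y mod 2 = 1) as [F|F] by lia; rewrite F in Ho; [discriminate|]; auto. }
destruct (Z.eq_dec (w mod 2) 0) as [E|E].
- replace (- w) with (-2 * (w / 2)) by (pose proof (Z.div_mod w 2); lia).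
  apply (has_reduced_nonneg (Z.to_nat (w / 2))); pose proof (Z.div_mod w 2); lia.
(* Both [w] and [g] are odd, so after a reflection the even number [g - w] takes the place of
   [w]. *)
- apply has_reduced_reflect, (has_reduced_change _ _ _ _ 1 0 (-1) 1); [ring|].
  pose proof (has_reduced_nonneg (Z.to_nat g) g y 0 ((g - w) / 2)) as H.
  pose proof (Z.div_mod (g - w) 2).
  replace (1 * g + 0 * - - w) with g by ring.
  replace (1 * - 0 + 0 * y) with 0 by ring.
  replace (-1 * g + 1 * - - w) with (-2 * ((g - w) / 2)) by lia.
  replace (-1 * - 0 + 1 * y) with y by ring.
  apply H; lia.
Qed.

(** * Uniqueness of the reduced basis *)

Lemma quad_nonneg p q a c D : p <> 0 -> q <> 0 -> - a < D < a -> - c < D < c ->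
  0 <= (p * p - 1) * a - 2 * p * q * D + 2 * q * q * c.
Proof.
intros Hp Hq Ha Hc.
assert (Hpp : 1 <= p * p) by nia.
assert (Hqq : 1 <= q * q) by nia.
(* Replacing [a] and [c] by [|D|] leaves at least [((|p| - |q|)^2 + q^2 - 1) |D|]. *)
assert (H1 : (p * p - 1) * Z.abs D <= (p * p - 1) * a) by (apply Z.mul_le_mono_nonneg_l; lia).
assert (H2 : (q * q) * Z.abs D <= (q * q) * c) by (apply Z.mul_le_mono_nonneg_l; lia).
assert (H3 : 0 <= (p * p - 2 * p * q + q * q) * Z.abs D).
{ apply Z.mul_nonneg_nonneg; [|lia].
  replace (p * p - 2 * p * q + q * q) with ((p - q) * (p - q)) by ring; apply Z.square_nonneg. }
assert (H4 : 0 <= (p * p + 2 * p * q + q * q) * Z.abs D).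
{ apply Z.mul_nonneg_nonneg; [|lia].
  replace (p * p + 2 * p * q + q * q) with ((p + q) * (p + q)) by ring; apply Z.square_nonneg. }
assert (H5 : Z.abs D <= q * q * Z.abs D) by nia.
destruct (Z.abs_eq_or_opp D) as [E|E]; rewrite E in H1 H2 H3 H4 H5; lia.
Qed.

Lemma am_gm A B : 4 * (A * B) <= (A + B) * (A + B).
Proof. pose proof (Z.square_nonneg (A - B)); lia. Qed.

Lemma am_gm_det A B g : 0 < A -> 0 < B -> 0 < g -> A * B = (1 + 2 * g) * g -> 2 * g <= A + B.
Proof.
intros HA HB Hg H; apply Z.square_le_simpl_nonneg; [lia|].
pose proof (am_gm A B); lia.
Qed.

Lemma pos_sum_of_squares x y : y <> 0 -> 0 <= x * x + y * y - 1.
Proof. intros Hy; pose proof (Z.square_nonneg x); nia. Qed.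

(** With [S = q + r], [T = p + s], [G = q r] this becomes [et <= al + ga] in [no_positive_change].
    The difference of the squared sides contains [16 G (G - 4)], whence [4 <= G]. *)
Lemma double_cross_le S T G d e : 4 <= G -> 0 <= S -> 0 <= T ->
  S * S = e * e + 4 * G -> T * T = d * d + 4 + 8 * G ->
  2 * S * T <= 2 * (S * S) + 4 * G + d * d.
Proof.
intros HG HS HT ES ET.
pose proof (Z.square_nonneg e) as He; pose proof (Z.square_nonneg d) as Hd.
apply Z.square_le_simpl_nonneg; [lia|].
replace (2 * S * T * (2 * S * T)) with (4 * (S * S) * (T * T)) by ring.
rewrite ES ET; revert He Hd; generalize (e * e) (d * d); intros x y Hx Hy.
assert (0 <= x * (G - 1)) by (apply Z.mul_nonneg_nonneg; lia).
assert (0 <= G * (G - 4)) by (apply Z.mul_nonneg_nonneg; lia).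
assert (0 <= G * y) by (apply Z.mul_nonneg_nonneg; lia).
pose proof (Z.square_nonneg x); pose proof (Z.square_nonneg y).
lia.
Qed.

Section TwoBases.
Variables a c u v a' c' u' v' p q r s : Z.
Hypothesis Hred : reduced a c u v.
Hypothesis Hred' : reduced a' c' u' v'.
Hypothesis Hdet : p * s - 2 * q * r = 1.
Hypothesis Ea : a' = p * a - 2 * q * v.
Hypothesis Eu : u' = p * u + q * c.
Hypothesis Ev : v' = s * v - r * a.
Hypothesis Ec : c' = 2 * r * u + s * c.

(** The matrix of the change of basis has rows [(p, q)] and [(2r, s)]. The number
    [2q (v' - u') + (s - p) a'] is minus the form of [quad_nonneg]; if [s - p >= 2|q|], then
    [|u' - v'| < a'] would make it positive. *)
Lemma diff_lt_upper : q <> 0 -> s - p < 2 * Z.abs q.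
Proof.
intros Hq; destruct Hred as (A1 & A2 & _ & A4 & A5), Hred' as (B1 & B2 & _ & B4 & B5).
apply Z.nle_gt; intros H.
assert (Hp : p <> 0) by (intros ->; lia).
pose proof (quad_nonneg p q a c (v - u) Hp Hq ltac:(lia) ltac:(lia)) as HQ.
assert (E : 2 * q * (v' - u') + (s - p) * a'
  = - ((p * p - 1) * a - 2 * p * q * (v - u) + 2 * q * q * c)).
{ assert (Es : p * s = 1 + 2 * q * r) by lia.
  rewrite Ea Eu Ev.
  replace (2 * q * (s * v - r * a - (p * u + q * c)) + (s - p) * (p * a - 2 * q * v))
    with ((p * s) * a - p * p * a - 2 * q * r * a - 2 * p * q * u - 2 * q * q * c + 2 * p * q * v) by ring.
  rewrite Es; ring. }
assert (H1 : 2 * Z.abs q * a' <= (s - p) * a') by (apply Z.mul_le_mono_nonneg_r; lia).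
assert (H2 : 0 < 2 * Z.abs q * a' + 2 * q * (v' - u')) by nia.
lia.
Qed.

Lemma diff_gt_lower : r <> 0 -> p - s < 2 * Z.abs r.
Proof.
intros Hr; destruct Hred as (A1 & A2 & _ & A4 & A5), Hred' as (B1 & B2 & _ & B4 & B5).
apply Z.nle_gt; intros H.
assert (Hs : s <> 0) by (intros ->; lia).
pose proof (quad_nonneg s r c a (v - u) Hs Hr ltac:(lia) ltac:(lia)) as HQ.
assert (E : 2 * r * (v' - u') + (p - s) * c'
  = - ((s * s - 1) * c - 2 * s * r * (v - u) + 2 * r * r * a)).
{ assert (Es : p * s = 1 + 2 * q * r) by lia.
  rewrite Ec Eu Ev.
  replace (2 * r * (s * v - r * a - (p * u + q * c)) + (p - s) * (2 * r * u + s * c))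
    with (2 * r * s * v - 2 * r * r * a - 2 * q * r * c + (p * s) * c - 2 * r * s * u - s * s * c) by ring.
  rewrite Es; ring. }
assert (H1 : 2 * Z.abs r * c' <= (p - s) * c') by (apply Z.mul_le_mono_nonneg_r; lia).
assert (H2 : 0 < 2 * Z.abs r * c' + 2 * r * (v' - u')) by nia.
lia.
Qed.

(** For positive [p, s], positive multiples of [a' + v' - u'] and [c' + v' - u'] add up to
    [-(al a + ga c - et D)], which cannot be positive because [D < min a c] and
    [0 <= et <= al + ga]. For negative [p, s] it is [r a' + q c'] that cannot be positive. *)
Lemma no_positive_change : 0 < q -> 0 < r -> (q - r) mod 2 = 0 ->
  - 2 * q < s - p < 2 * q -> - 2 * r < s - p < 2 * r -> False.
Proof.
intros Hq Hr Hpar Hdq Hdr.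
destruct Hred as (A1 & A2 & _ & A4 & A5), Hred' as (B1 & B2 & _ & B4 & B5).
assert (Es : p * s = 1 + 2 * (q * r)) by lia.
assert (HG : 0 < q * r) by (apply Z.mul_pos_pos; lia).
set (D := v - u) in *.
assert (Esum : r * a' + q * c' = p * r * a + s * q * c - 2 * (q * r) * D).
{ rewrite Ea Ec /D; ring. }
assert (Hps : (0 < p /\ 0 < s) \/ (p < 0 /\ s < 0)).
{ assert (H : 0 < p * s) by lia; apply Z.lt_0_mul in H; tauto. }
destruct Hps as [[Hp Hs]|[Hp Hs]].
- set (al := (p - r) * (p - r) + r * r - 1).
  set (ga := (s - q) * (s - q) + q * q - 1).
  set (et := 2 * p * q + 2 * s * r - 4 * (q * r)).
  assert (Hal : 0 <= al) by (apply pos_sum_of_squares; lia).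
  assert (Hga : 0 <= ga) by (apply pos_sum_of_squares; lia).
  assert (Het : 0 <= et).
  { assert (2 * (q * r) <= p * q + s * r); [|unfold et; lia].
    apply am_gm_det; try (apply Z.mul_pos_pos; lia).
    rewrite -Es; ring. }
  assert (Hsum : et <= al + ga).
  { assert (HG4 : 4 <= q * r).
    (* If [q r <= 3], one of [q, r] is 1, so the even number [s - p] vanishes and [p^2 = 1 + 2 q r]
       would be 3, 5 or 7. *)
    { assert (Hc : q * r <= 3 \/ 4 <= q * r) by lia; destruct Hc as [Hc|Hc]; [|exact Hc].
      assert (q <= 3 /\ r <= 3) by (clear -Hq Hr Hc; nia).
      assert (Hq3 : q = 1 \/ q = 2 \/ q = 3) by lia.
      assert (Hr3 : r = 1 \/ r = 2 \/ r = 3) by lia.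
      assert (p mod 2 = 1 /\ s mod 2 = 1).
      { assert (Hm : (p * s) mod 2 = 1) by (rewrite Es; lia).
        rewrite Zmult_mod in Hm.
        assert (p mod 2 = 0 \/ p mod 2 = 1) as [F|F] by lia; rewrite F in Hm; [discriminate|].
        assert (s mod 2 = 0 \/ s mod 2 = 1) as [F'|F'] by lia; rewrite F' in Hm; [discriminate|]; auto. }
      destruct Hq3 as [-> | [-> | ->]], Hr3 as [-> | [-> | ->]]; try lia;
        try (assert (s = p) by lia; clear -H Hp Es; subst s; assert (p = 1 \/ p = 2 \/ 3 <= p) as [?|[?|?]] by lia; nia). }
    pose proof (double_cross_le (q + r) (p + s) (q * r) (s - p) (q - r)) as HH.
    assert (2 * (q + r) * (p + s) <= 2 * ((q + r) * (q + r)) + 4 * (q * r) + (s - p) * (s - p)).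
    { apply HH; try lia; ring_simplify; rewrite ?Es; ring_simplify;
        replace (p * s) with (1 + 2 * (q * r)) by lia; ring. }
    unfold al, ga, et; replace ((s - p) * (s - p)) with (s * s + p * p - 2 * (p * s)) in H by ring.
    rewrite Es in H; lia. }
  assert (Hlin : al * a + ga * c - et * D < 0).
  { assert (Hx : 0 < 2 * q - (s - p)) by lia.
    assert (Hy : 0 < 2 * r + (s - p)) by lia.
    assert (F1 : 0 < (2 * r + (s - p)) * (a' + (v' - u'))) by (apply Z.mul_pos_pos; lia).
    assert (F2 : 0 < (2 * q - (s - p)) * (c' + (v' - u'))) by (apply Z.mul_pos_pos; lia).
    assert (EF : (2 * r + (s - p)) * (a' + (v' - u')) + (2 * q - (s - p)) * (c' + (v' - u'))
      = - (al * a + ga * c - et * D)).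
    { rewrite Ea Ec Eu Ev /al /ga /et /D.
      match goal with |- ?l = ?rr => transitivity
        (rr + (p * s - 2 * q * r - 1) * (a + c)); [ring|rewrite Hdet; ring] end. }
    lia. }
  destruct (Z_le_gt_dec 0 D) as [HD|HD].
  + assert (al * D <= al * a) by (apply Z.mul_le_mono_nonneg_l; lia).
    assert (ga * D <= ga * c) by (apply Z.mul_le_mono_nonneg_l; lia).
    assert (et * D <= (al + ga) * D) by (apply Z.mul_le_mono_nonneg_r; lia).
    lia.
  + assert (0 <= al * a) by (apply Z.mul_nonneg_nonneg; lia).
    assert (0 <= ga * c) by (apply Z.mul_nonneg_nonneg; lia).
    assert (0 <= et * - D) by (apply Z.mul_nonneg_nonneg; lia).
    lia.
- assert (H2 : 2 * (q * r) <= - p * r + - s * q) by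
    (apply am_gm_det; [apply Z.mul_pos_pos; lia|apply Z.mul_pos_pos; lia|exact HG|rewrite -Es; ring]).
  assert (0 < r * a') by (apply Z.mul_pos_pos; lia).
  assert (0 < q * c') by (apply Z.mul_pos_pos; lia).
  assert (0 < - p * r) by (apply Z.mul_pos_pos; lia).
  assert (0 < - s * q) by (apply Z.mul_pos_pos; lia).
  assert (- p * r * Z.abs D <= - p * r * a) by (apply Z.mul_le_mono_nonneg_l; lia).
  assert (- s * q * Z.abs D <= - s * q * c) by (apply Z.mul_le_mono_nonneg_l; lia).
  assert (2 * (q * r) * Z.abs D <= (- p * r + - s * q) * Z.abs D)
    by (apply Z.mul_le_mono_nonneg_r; lia).
  assert (2 * (q * r) * (- D) <= 2 * (q * r) * Z.abs D) by (apply Z.mul_le_mono_nonneg_l; lia).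
  lia.
Qed.
End TwoBases.

(** The bounds for the change and for its inverse, with entries [s, -q, -2r, p], give
    [|s - p| < 2 min(|q|, |r|)]. If [q r < 0], this contradicts [(s - p)^2 = (s + p)^2 - 4 - 8 q r];
    if [q r > 0], the change or its inverse has both off-diagonal entries positive. *)
Lemma change_signs a c u v a' c' u' v' p q r s :
  reduced a c u v -> reduced a' c' u' v' -> p * s - 2 * q * r = 1 ->
  a' = p * a - 2 * q * v -> u' = p * u + q * c -> v' = s * v - r * a -> c' = 2 * r * u + s * c ->
  q <> 0 -> r <> 0 -> (q - r) mod 2 = 0 -> False.
Proof.
intros H H' Hdet Ea Eu Ev Ec Hq Hr Hpar.
assert (Ia : a = s * a' - 2 * (- q) * v').
{ rewrite Ea Ev; transitivity (a * (p * s - 2 * q * r)); [rewrite Hdet|]; ring. }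
assert (Iu : u = s * u' + - q * c').
{ rewrite Eu Ec; transitivity (u * (p * s - 2 * q * r)); [rewrite Hdet|]; ring. }
assert (Iv : v = p * v' - - r * a').
{ rewrite Ev Ea; transitivity (v * (p * s - 2 * q * r)); [rewrite Hdet|]; ring. }
assert (Ic : c = 2 * - r * u' + p * c').
{ rewrite Eu Ec; transitivity (c * (p * s - 2 * q * r)); [rewrite Hdet|]; ring. }
assert (Idet : s * p - 2 * - q * - r = 1) by (rewrite -Hdet; ring).
assert (Hq' : - q <> 0) by lia; assert (Hr' : - r <> 0) by lia.
assert (B1 : s - p < 2 * Z.abs q) by (eapply (diff_lt_upper a c u v a' c' u' v'); eassumption).
assert (B2 : p - s < 2 * Z.abs r) by (eapply (diff_gt_lower a c u v a' c' u' v'); eassumption).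
assert (B3 : p - s < 2 * Z.abs (- q)) by (eapply (diff_lt_upper a' c' u' v' a c u v); eassumption).
assert (B4 : s - p < 2 * Z.abs (- r)) by (eapply (diff_gt_lower a' c' u' v' a c u v); eassumption).
assert (Hneg : q * r < 0 -> False).
{ intros Hqr.
  assert (Habs : Z.abs q * Z.abs r = - (q * r)) by (rewrite -Z.abs_mul; lia).
  assert ((s - p) * (s - p) = (s + p) * (s + p) - 4 * (1 + 2 * (q * r))) as E.
  { transitivity ((s + p) * (s + p) - 4 * (p * s)); [ring|]; rewrite -Hdet; ring. }
  pose proof (Z.square_nonneg (s + p)).
  assert (Hlt : (s - p) * (s - p) < 2 * Z.abs q * (2 * Z.abs r)).
  { rewrite -(Z.abs_square (s - p)); apply Z.mul_lt_mono_nonneg; lia. }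
  lia. }
assert (Hs : 0 < q /\ 0 < r \/ q < 0 /\ r < 0).
{ assert (q * r <> 0) by (apply Z.neq_mul_0; auto).
  assert (Hqr : 0 < q * r) by lia; apply Z.lt_0_mul in Hqr; tauto. }
destruct Hs as [[Hq0 Hr0]|[Hq0 Hr0]].
- apply (no_positive_change a c u v a' c' u' v' p q r s); auto; lia.
- apply (no_positive_change a' c' u' v' a c u v s (- q) (- r) p); auto; lia.
Qed.

Lemma reduced_unique a c u v a' c' u' v' p q g s :
  reduced a c u v -> reduced a' c' u' v' -> a mod 2 = 1 -> c mod 2 = 1 -> p * s - q * g = 1 ->
  a' = p * a + q * (-2 * v) -> u' = p * u + q * c ->
  -2 * v' = g * a + s * (-2 * v) -> c' = g * u + s * c ->
  a' = a /\ c' = c /\ u' = u /\ v' = v.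
Proof.
intros H H' Hao Hco Hdet Ea Eu Ev Ec.
assert (Hg : exists r, g = 2 * r).
{ exists (g / 2).
  assert (Hm : (g * a) mod 2 = 0).
  { replace (g * a) with ((s * v - v') * 2) by lia; apply Z_mod_mult. }
  rewrite Zmult_mod Hao in Hm.
  assert (g mod 2 = 0 \/ g mod 2 = 1) as [F|F] by lia; [lia|rewrite F in Hm; discriminate]. }
destruct Hg as [r ->].
assert (Ev' : v' = s * v - r * a) by lia.
assert (Hpo : p mod 2 = 1 /\ s mod 2 = 1).
{ assert (Hm : (p * s) mod 2 = 1).
  { replace (p * s) with (1 + (q * r) * 2) by lia; rewrite Z_mod_plus_full; reflexivity. }
  rewrite Zmult_mod in Hm.
  assert (p mod 2 = 0 \/ p mod 2 = 1) as [F|F] by lia; rewrite F in Hm; [discriminate|].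
  assert (s mod 2 = 0 \/ s mod 2 = 1) as [F'|F'] by lia; rewrite F' in Hm; [discriminate|]; auto. }
(* Since [p, s, a, c] are odd, [u' - v'] is congruent to [u - v + q + r] modulo 2, and both
   differences are even. *)
assert (Hpar : (q - r) mod 2 = 0).
{ destruct H as (_ & _ & He & _), H' as (_ & _ & He' & _).
  apply Z.mod_divide; [lia|].
  apply Z.mod_divide in He; [|lia]; apply Z.mod_divide in He'; [|lia].
  destruct He as [e He], He' as [e' He'].
  assert (Dp : exists p0, p = 2 * p0 + 1) by (exists (p / 2); lia).
  assert (Ds : exists s0, s = 2 * s0 + 1) by (exists (s / 2); lia).
  assert (Da : exists a0, a = 2 * a0 + 1) by (exists (a / 2); lia).
  assert (Dc : exists c0, c = 2 * c0 + 1) by (exists (c / 2); lia).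
  destruct Dp as [p0 Dp], Ds as [s0 Ds], Da as [a0 Da], Dc as [c0 Dc].
  exists (e' - e - p0 * u - q * c0 + s0 * v - r * a0 - r).
  rewrite Eu Ev' Dp Ds Da Dc in He'; lia. }
destruct (Z.eq_dec q 0) as [Hq|Hq].
- subst q.
  assert (Hps : p = 1 /\ s = 1).
  { assert (Hps : p * s = 1) by lia.
    apply Z.mul_eq_1 in Hps as Hp1; destruct Hp1 as [-> | ->]; [lia|].
    destruct H as (A1 & _), H' as (B1 & _); lia. }
  destruct Hps as [-> ->].
  destruct H as (A1 & A2 & A3 & A4 & A5), H' as (B1 & B2 & B3 & B4 & B5).
  assert (Hr : r = 0).
  { assert (- (2 * a) < r * a < 2 * a) by lia.
    assert (-2 < r < 2) by (clear -A1 H; nia). lia. }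
  subst r; lia.
- destruct (Z.eq_dec r 0) as [Hr|Hr].
  + subst r.
    assert (Hps : p = 1 /\ s = 1).
    { assert (Hps : p * s = 1) by lia.
      apply Z.mul_eq_1 in Hps as Hp1; destruct Hp1 as [-> | ->]; [lia|].
      destruct H as (_ & A1 & _), H' as (_ & B1 & _); lia. }
    destruct Hps as [-> ->].
    destruct H as (A1 & A2 & A3 & A4 & A5), H' as (B1 & B2 & B3 & B4 & B5).
    assert (Hq0 : q = 0).
    { assert (- (2 * c) < q * c < 2 * c) by lia.
      assert (-2 < q < 2) by (clear -A2 H; nia). lia. }
    subst q; lia.
  + exfalso; apply (change_signs a c u v a' c' u' v' p q r s); auto; lia.
Qed.

(** * Hermite normal forms and the count of sublattices *)

Lemma odd_mul x y : (x * y) mod 2 = 1 -> x mod 2 = 1 /\ y mod 2 = 1.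
Proof.
rewrite Zmult_mod; intros H.
assert (x mod 2 = 0 \/ x mod 2 = 1) as [E|E] by lia; rewrite E in H; [discriminate|].
assert (y mod 2 = 0 \/ y mod 2 = 1) as [F|F] by lia; rewrite F in H; [discriminate|]; auto.
Qed.

Lemma abs_le_square x : Z.abs x <= x * x.
Proof. rewrite -Z.abs_square; pose proof (Z.abs_nonneg x); nia. Qed.

(** The triple stands for the sublattice of index [N] with basis [(g, 0)], [(-w, y)]. The
    cardinality is the sum of the divisors of [N]; it is never evaluated and serves as the common
    value of the lattice and four-square counts. *)
Definition hermite (N : Z) (t : Z * Z * Z) : Prop :=
  let '(g, w, y) := t in 0 < g /\ 0 < y /\ g * y = N /\ 0 <= w < g.

Definition reduced_bases (N : Z) (t : Z * Z * Z * Z) : Prop :=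
  let '(a, c, u, v) := t in reduced a c u v /\ a * c + 2 * u * v = N.

Lemma finite_hermite N : finite (hermite N).
Proof.
apply (finite_Z3 _ (Z.abs N)); intros g w y (Hg & Hy & H & Hw).
assert (g <= N /\ y <= N) by (clear -Hg Hy H; nia); lia.
Qed.

Lemma finite_reduced_bases N : finite (reduced_bases N).
Proof.
apply (finite_Z4 _ (2 * Z.abs N)); intros a c u v ((Ha & Hc & _ & H1 & H2) & HN).
assert (Hac : (u - v) * (u - v) < a * c).
{ rewrite -(Z.abs_square (u - v)); apply Z.mul_lt_mono_nonneg; lia. }
assert (Hk : 2 * (a * c) + (u + v) * (u + v) - (u - v) * (u - v) = 2 * N) by (rewrite -HN; ring).
pose proof (Z.square_nonneg (u + v)); pose proof (Z.square_nonneg (u - v)).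
assert (a <= a * c /\ c <= a * c) by (clear -Ha Hc; nia).
pose proof (abs_le_square (u + v)).
lia.
Qed.

Definition hermite_form (t : Z * Z * Z * Z) (h : Z * Z * Z) : Prop :=
  let '(a, c, u, v) := t in let '(g, w, y) := h in basis_of g 0 (- w) y a c u v.

Lemma basis_of_det x z w y a c u v : basis_of x z w y a c u v ->
  a * c + 2 * u * v = x * y - z * w.
Proof.
intros (al & be & ga & de & H1 & Ea & Eu & Ev & Ec).
transitivity (a * c - u * (-2 * v)); [ring|].
rewrite Ev Ea Eu Ec; transitivity ((al * de - be * ga) * (x * y - z * w)); [ring|rewrite H1; ring].
Qed.

Lemma hermite_form_exists N t : 0 < N -> reduced_bases N t ->
  exists h, hermite N h /\ hermite_form t h.
Proof.
destruct t as [[[a c] u] v]; intros HN ((Ha & Hc & _) & Hdet).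
destruct (Zis_gcd_bezout u c (Z.gcd u c) (Zgcd_is_gcd u c)) as [s0 t0 Hst].
destruct (Z.gcd_divide_l u c) as [u1 Hu1], (Z.gcd_divide_r u c) as [c1 Hc1].
assert (Hy : 0 < Z.gcd u c).
{ pose proof (Z.gcd_nonneg u c); assert (Z.gcd u c <> 0) by (intros E; apply Z.gcd_eq_0_r in E; lia); lia. }
set (y := Z.gcd u c) in *; clearbody y.
(* For the rows [R1 = (a, u)] and [R2 = (-2v, c)] one has [c1 R1 - u1 R2 = (g, 0)] and, by Bezout,
   [s0 R1 + t0 R2 = (-w0, y)]; a multiple of the former brings [w0] into [[0, g)]. *)
set (g := a * c1 + 2 * u1 * v).
assert (Hgy : g * y = N) by (rewrite -Hdet Hu1 Hc1 /g; ring).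
assert (Hg : 0 < g) by (clear -Hgy HN Hy; nia).
set (w0 := - (s0 * a - 2 * t0 * v)).
exists (g, w0 mod g, y); split.
- unfold hermite; pose proof (Z.mod_pos_bound w0 g Hg); auto.
- assert (Hone : s0 * u1 + t0 * c1 = 1).
  { rewrite Hu1 Hc1 in Hst; clear -Hst Hy.
    apply (Z.mul_reg_r _ _ y); [lia|]; rewrite -{3}(Z.mul_1_l y) in Hst; lia. }
  set (m := w0 / g).
  assert (Hw : w0 mod g = w0 - g * m) by (rewrite /m; pose proof (Z.div_mod w0 g); lia).
  rewrite /hermite_form Hw.
  exists (t0 - u1 * m), u1, (- s0 - c1 * m), c1; repeat split.
  + rewrite -Hone; ring.
  + rewrite /w0 /g; transitivity (a * (s0 * u1 + t0 * c1)); [rewrite Hone|]; ring.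
  + rewrite {1}Hu1; ring.
  + rewrite /w0 /g; transitivity (-2 * v * (s0 * u1 + t0 * c1)); [rewrite Hone|]; ring.
  + rewrite {1}Hc1; ring.
Qed.

Lemma hermite_form_unique N t h h' :
  hermite N h -> hermite N h' -> hermite_form t h -> hermite_form t h' -> h = h'.
Proof.
destruct t as [[[a c] u] v], h as [[g w] y], h' as [[g' w'] y'].
intros (Hg & Hy & _ & Hw) (Hg' & Hy' & _ & Hw').
intros (al & be & ga & de & H1 & Ea & Eu & Ev & Ec) (al' & be' & ga' & de' & H1' & Ea' & Eu' & Ev' & Ec').
(* Entries of the transition matrix between the two Hermite bases: [k2 = 0] makes it triangular,
   positivity makes its diagonal 1, and the bounds on [w, w'] leave only the identity. *)
set (k1 := de' * al - be' * ga); set (k2 := de' * be - be' * de).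
set (k3 := al' * ga - ga' * al); set (k4 := al' * de - ga' * be).
assert (F1 : g' = k1 * g - k2 * w).
{ transitivity (de' * a - be' * (-2 * v)); [rewrite Ea' Ev'|rewrite Ea Ev /k1 /k2; ring].
  transitivity (g' * (al' * de' - be' * ga')); [rewrite H1'|]; ring. }
assert (F2 : 0 = k2 * y).
{ transitivity (de' * u - be' * c); [rewrite Eu' Ec'; ring|rewrite Eu Ec /k2; ring]. }
assert (F3 : - w' = k3 * g - k4 * w).
{ transitivity (al' * (-2 * v) - ga' * a); [rewrite Ea' Ev'|rewrite Ea Ev /k3 /k4; ring].
  transitivity (- w' * (al' * de' - be' * ga')); [rewrite H1'|]; ring. }
assert (F4 : y' = k4 * y).
{ transitivity (al' * c - ga' * u); [rewrite Eu' Ec'|rewrite Eu Ec /k4; ring].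
  transitivity (y' * (al' * de' - be' * ga')); [rewrite H1'|]; ring. }
assert (F5 : k1 * k4 - k2 * k3 = 1).
{ transitivity ((al' * de' - be' * ga') * (al * de - be * ga)); [rewrite /k1 /k2 /k3 /k4; ring|].
  rewrite H1 H1'; ring. }
assert (k2 = 0) by (clear -F2 Hy; nia).
assert (Hk : k1 * k4 = 1) by lia.
assert (k1 = 1 /\ k4 = 1) as [K1 K4].
{ assert (0 < k4) by (clear -F4 Hy Hy'; nia).
  pose proof Hk as Hk'; apply Z.mul_eq_1 in Hk' as [E|E]; rewrite E in Hk; lia. }
assert (k3 = 0) by (rewrite K4 in F3; clear -F3 Hw Hw' Hg F1 K1 H; nia).
repeat f_equal; lia.
Qed.

Lemma reduced_basis_exists N h : N mod 2 = 1 -> hermite N h ->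
  exists t, reduced_bases N t /\ hermite_form t h.
Proof.
destruct h as [[g w] y]; intros HN (Hg & Hy & Hgy & Hw).
destruct (has_reduced_hermite g w y) as (a & c & u & v & Hr & Hb); [lia|lia|congruence|lia|].
exists (a, c, u, v); repeat split; try apply Hr; auto.
rewrite (basis_of_det _ _ _ _ _ _ _ _ Hb); lia.
Qed.

Lemma reduced_basis_unique N t t' h : N mod 2 = 1 ->
  reduced_bases N t -> reduced_bases N t' -> hermite_form t h -> hermite_form t' h -> t = t'.
Proof.
destruct t as [[[a c] u] v], t' as [[[a' c'] u'] v'], h as [[g w] y].
intros HN (Hr & Hdet) (Hr' & Hdet').
intros (al & be & ga & de & H1 & Ea & Eu & Ev & Ec) (al' & be' & ga' & de' & H1' & Ea' & Eu' & Ev' & Ec').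
assert (Ho : a mod 2 = 1 /\ c mod 2 = 1).
{ apply odd_mul; replace (a * c) with (N + (- (u * v)) * 2) by lia; rewrite Z_mod_plus_full; exact HN. }
destruct (reduced_unique a c u v a' c' u' v' (al' * de - be' * ga) (be' * al - al' * be)
   (ga' * de - de' * ga) (de' * al - ga' * be)) as (E1 & E2 & E3 & E4); try tauto.
- transitivity ((al' * de' - be' * ga') * (al * de - be * ga)); [ring|rewrite H1 H1'; ring].
- rewrite Ev Ea Ea'; transitivity ((al * de - be * ga) * (al' * g + be' * - w)); [rewrite H1|]; ring.
- rewrite Eu Ec Eu'; transitivity ((al * de - be * ga) * (al' * 0 + be' * y)); [rewrite H1|]; ring.
- rewrite Ev Ea Ev'; transitivity ((al * de - be * ga) * (ga' * g + de' * - w)); [rewrite H1|]; ring.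
- rewrite Eu Ec Ec'; transitivity ((al * de - be * ga) * (ga' * 0 + de' * y)); [rewrite H1|]; ring.
- congruence.
Qed.

Lemma card_reduced_bases N : 0 < N -> N mod 2 = 1 -> setcard (reduced_bases N) = setcard (hermite N).
Proof.
intros H0 HN; apply Z.le_antisymm.
- apply (setcard_le_rel _ _ hermite_form); [apply finite_reduced_bases|apply finite_hermite| |].
  + intros t; now apply hermite_form_exists.
  + intros t t' h Ht Ht' _; now apply (reduced_basis_unique N).
- apply (setcard_le_rel _ _ (fun h t => hermite_form t h));
    [apply finite_hermite|apply finite_reduced_bases| |].
  + intros h; now apply reduced_basis_exists.
  + intros h h' t Hh Hh' _; now apply (hermite_form_unique N).
Qed.

(** * Dirichlet's identity *)

Definition chi (x : Z) : Z := if x mod 4 =? 1 then 1 else if x mod 4 =? 3 then -1 else 0.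

(* [cos4 x = cos (pi * x / 2)] *)
Definition cos4 (x : Z) : Z := if x mod 4 =? 0 then 1 else if x mod 4 =? 2 then -1 else 0.

Ltac chi_cases :=
  unfold chi, cos4 in *;
  repeat match goal with
  | |- context [?x =? ?y] => destruct (Z.eqb_spec x y)
  | H : context [?x =? ?y] |- _ => destruct (Z.eqb_spec x y)
  end.

(** On odd numbers [chi x = sin (pi * x / 2)], so this is the product formula for sines. *)
Lemma chi_cos4 a s : a mod 2 = 1 -> s mod 2 = 1 -> 2 * (chi a * chi s) = cos4 (a - s) - cos4 (a + s).
Proof. intros Ha Hs; chi_cases; lia. Qed.

Lemma cos4_opp x : cos4 (- x) = cos4 x.
Proof. chi_cases; lia. Qed.

Lemma cos4_shift x y : (x + y) mod 4 = 2 -> x mod 2 = 0 -> cos4 y = - cos4 x.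
Proof. intros H Hx; chi_cases; lia. Qed.

Definition odd_quads (M : Z) (x : Z * Z * Z * Z) : Prop :=
  let '(a, c, s, t) := x in
  (0 < a /\ 0 < c /\ 0 < s /\ 0 < t) /\
  (a mod 2 = 1 /\ c mod 2 = 1 /\ s mod 2 = 1 /\ t mod 2 = 1) /\ a * c + s * t = M.

Definition even_quads (M : Z) (x : Z * Z * Z * Z) : Prop :=
  let '(a, c, s, t) := x in
  (0 < a /\ 0 < c /\ 0 < s /\ 0 < t) /\
  (a mod 2 = 0 /\ c mod 2 = 1 /\ s mod 2 = 1 /\ t mod 2 = 0) /\ a * c + s * t = M.

Lemma pos_quads_bound a c s t M : 0 < a -> 0 < c -> 0 < s -> 0 < t -> a * c + s * t = M ->
  a <= M /\ c <= M /\ s <= M /\ t <= M.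
Proof. intros; nia. Qed.

Lemma finite_odd_quads M (R : Z * Z * Z * Z -> Prop) : finite (fun x => odd_quads M x /\ R x).
Proof.
apply (finite_Z4 _ (Z.abs M)); intros a c s t [(H1 & _ & H2) _].
pose proof (pos_quads_bound a c s t M); lia.
Qed.

Lemma finite_even_quads M (R : Z * Z * Z * Z -> Prop) : finite (fun x => even_quads M x /\ R x).
Proof.
apply (finite_Z4 _ (Z.abs M)); intros a c s t [(H1 & _ & H2) _].
pose proof (pos_quads_bound a c s t M); lia.
Qed.

Lemma finite_odd_quads0 M : finite (odd_quads M).
Proof. apply (finite_sub _ _ (finite_odd_quads M (fun _ => True))); tauto. Qed.

Lemma finite_even_quads0 M : finite (even_quads M).
Proof. apply (finite_sub _ _ (finite_even_quads M (fun _ => True))); tauto. Qed.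

(** [(a/2) c + s (t/2)] is the odd number [N], with [c] and [s] odd. *)
Lemma even_quads_mod4 N a c s t : N mod 2 = 1 -> even_quads (2 * N) (a, c, s, t) ->
  (a + t) mod 4 = 2.
Proof.
intros HN (_ & (Ha & Hc & Hs & Ht) & H).
assert (a = 2 * (a / 2) /\ t = 2 * (t / 2) /\ c = 2 * (c / 2) + 1 /\ s = 2 * (s / 2) + 1) by lia.
revert H0; generalize (a / 2) (t / 2) (c / 2) (s / 2); intros A B C S (E1 & E2 & E3 & E4).
rewrite E1 E2 E3 E4 in H.
assert (N = A + B + 2 * (A * C + S * B)) by lia.
revert H0; generalize (A * C + S * B); intros k Hk; clear H; subst a t; lia.
Qed.

Lemma sum_eq_quads_cos4 N a c s t : N mod 2 = 1 -> odd_quads (2 * N) (a, c, s, t) -> t = c ->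
  cos4 (a + s) = -1.
Proof.
intros HN (_ & (Ha & Hc & Hs & Ht) & H) ->.
assert (a + s = 2 * ((a + s) / 2) /\ c = 2 * (c / 2) + 1) by lia.
assert (Hp : c * (a + s) = 2 * N) by lia.
revert H0 Hp; generalize (a + s) (c / 2) ((a + s) / 2); intros x C A (E1 & E2).
rewrite E1 E2; intros Hp.
assert (N = A + 2 * (A * C)) by lia.
revert H0; generalize (A * C); intros k Hk; clear Hp; chi_cases; lia.
Qed.

Ltac quads := unfold odd_quads, even_quads in *; intros; repeat split; try lia; try (repeat f_equal; lia).

(** In the two cosine sums the terms with [a = s], respectively [t = c], yield the Hermite count
    with opposite signs. Shears such as [(a - s, c, s, t + c)], which preserve [a c + s t], move the
    rest to [even_quads] as [2Y] and [2Y']. Exchanging [a] with [t] and [c] with [s] gives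
    [Y' = -Y], while [Y] and [Y'] both equal [-L]; so they vanish. *)
Lemma sum_chi_odd_quads N : N mod 2 = 1 ->
  wsum (odd_quads (2 * N)) (fun x => let '(a, c, s, t) := x in chi a * chi s) = setcard (hermite N).
Proof.
intros HN; set (M := 2 * N).
set (O := odd_quads M); set (E := even_quads M).
assert (H0 : forall w w', wsum O (fun x => let '(a, c, s, t) := x in w a s - w' a s) =
   wsum O (fun x => let '(a, c, s, t) := x in w a s) - wsum O (fun x => let '(a, c, s, t) := x in w' a s)).
{ intros w w'; rewrite -(Z.mul_1_l (wsum _ (fun x => let '(a, c, s, t) := x in w a s))).
  rewrite (_ : forall x y, 1 * x - y = 1 * x + -1 * y); [|intros; ring].
  rewrite -wsum_lin; apply wsum_ext; [apply finite_odd_quads0|tauto|].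
  intros [[[a c] s] t] _; ring. }
assert (H1 : 2 * wsum O (fun x => let '(a, c, s, t) := x in chi a * chi s) =
  wsum O (fun x => let '(a, c, s, t) := x in cos4 (a - s)) -
  wsum O (fun x => let '(a, c, s, t) := x in cos4 (a + s))).
{ rewrite -wsum_scale -H0; apply wsum_ext; [apply finite_odd_quads0|tauto|].
  intros [[[a c] s] t] (_ & H & _); apply chi_cos4; tauto. }
set (Y := wsum (fun x => E x /\ let '(a, c, s, t) := x in c < t) (fun x => let '(a, c, s, t) := x in cos4 a)).
set (Y' := wsum (fun x => E x /\ let '(a, c, s, t) := x in s < a) (fun x => let '(a, c, s, t) := x in cos4 a)).
set (L := wsum (fun x => E x /\ let '(a, c, s, t) := x in a < s) (fun x => let '(a, c, s, t) := x in cos4 a)).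
assert (HW1 : wsum O (fun x => let '(a, c, s, t) := x in cos4 (a - s)) = setcard (hermite N) + 2 * Y).
{ rewrite (wsum_split O (fun x => O x /\ let '(a, c, s, t) := x in a = s)
     (fun x => O x /\ let '(a, c, s, t) := x in a <> s)); [|apply finite_odd_quads0| |].
  2: { intros [[[a c] s] t]; destruct (Z.eq_dec a s); tauto. }
  2: { intros [[[a c] s] t]; tauto. }
  f_equal.
  (* Here [a (c + t) = 2N]. With [g = (c + t) / 2], the odd number [c = 2w + 1 < 2g] takes [g]
     values. *)
  - apply (wsum_bij _ _ (fun x => let '(a, c, s, t) := x in ((c + t) / 2, c / 2, a))
      (fun x => let '(g, w, y) := x in (y, 2 * w + 1, y, 2 * g - 2 * w - 1))).
    + apply finite_odd_quads.
    + intros [[[a c] s] t] [(P & Q & H) ->]; unfold hermite.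
      assert (Hct : c + t = 2 * ((c + t) / 2)) by lia.
      assert (Hp : s * (c + t) = 2 * N) by (unfold M in H; lia).
      assert (Hg : (c + t) / 2 * s = N).
      { revert Hp; rewrite {1}Hct; generalize ((c + t) / 2); clear; intros; lia. }
      split; [repeat split; lia|split; [repeat f_equal; lia|]].
      rewrite Z.sub_diag; reflexivity.
    + intros [[g w] y] (P1 & P2 & P3 & P4).
      destruct (odd_mul g y) as [Q1 Q2]; [congruence|].
      split; [unfold O, odd_quads, M; repeat split; lia|repeat f_equal; lia].
  - rewrite (wsum_split _ (fun x => O x /\ let '(a, c, s, t) := x in s < a)
     (fun x => O x /\ let '(a, c, s, t) := x in a < s)); [|apply finite_odd_quads| |].
    2: { intros [[[a c] s] t]; assert (a <> s <-> s < a \/ a < s) by lia; tauto. }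
    2: { intros [[[a c] s] t]; lia. }
    rewrite -(wsum_bij (fun x => O x /\ let '(a, c, s, t) := x in s < a)
      (fun x => O x /\ let '(a, c, s, t) := x in a < s)
      (fun x => let '(a, c, s, t) := x in (s, t, a, c)) (fun x => let '(a, c, s, t) := x in (s, t, a, c))
      (fun x => let '(a, c, s, t) := x in cos4 (a - s))).
    2: apply finite_odd_quads.
    2: { intros [[[a c] s] t] [H H']; unfold O in *; quads. rewrite -cos4_opp; f_equal; ring. }
    2: { intros [[[a c] s] t] [H H']; unfold O in *; quads. }
    rewrite (wsum_bij (fun x => O x /\ let '(a, c, s, t) := x in s < a)
      (fun x => E x /\ let '(a, c, s, t) := x in c < t)
      (fun x => let '(a, c, s, t) := x in (a - s, c, s, t + c))
      (fun x => let '(a, c, s, t) := x in (a + s, c, s, t - c))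
      _ (fun x => let '(a, c, s, t) := x in cos4 a)).
    2: apply finite_odd_quads.
    2: { intros [[[a c] s] t] [H H']; unfold O, E in *; quads. }
    2: { intros [[[a c] s] t] [H H']; unfold O, E in *; quads. }
    unfold Y; ring. }
assert (HW2 : wsum O (fun x => let '(a, c, s, t) := x in cos4 (a + s)) = - setcard (hermite N) + 2 * Y').
{ rewrite (wsum_split O (fun x => O x /\ let '(a, c, s, t) := x in t = c)
     (fun x => O x /\ let '(a, c, s, t) := x in t <> c)); [|apply finite_odd_quads0| |].
  2: { intros [[[a c] s] t]; destruct (Z.eq_dec t c); tauto. }
  2: { intros [[[a c] s] t]; tauto. }
  f_equal.
  - rewrite (_ : forall x, - x = -1 * x); [|intros; ring].
    unfold setcard; rewrite -wsum_scale.
    apply (wsum_bij _ _ (fun x => let '(a, c, s, t) := x in ((a + s) / 2, a / 2, c))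
      (fun x => let '(g, w, y) := x in (2 * w + 1, y, 2 * g - 2 * w - 1, y))).
    + apply finite_odd_quads.
    + intros [[[a c] s] t] [HO HE]; pose proof (sum_eq_quads_cos4 N a c s t HN HO HE) as Hc.
      destruct HO as (P & Q & H); subst t; unfold hermite.
      assert (Hct : a + s = 2 * ((a + s) / 2)) by lia.
      assert (Hp : c * (a + s) = 2 * N) by (unfold M in H; lia).
      assert (Hg : (a + s) / 2 * c = N).
      { revert Hp; rewrite {1}Hct; generalize ((a + s) / 2); clear; intros; lia. }
      split; [repeat split; lia|split; [repeat f_equal; lia|lia]].
    + intros [[g w] y] (P1 & P2 & P3 & P4).
      destruct (odd_mul g y) as [Q1 Q2]; [congruence|].
      split; [unfold O, odd_quads, M; repeat split; lia|repeat f_equal; lia].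
  - rewrite (wsum_split _ (fun x => O x /\ let '(a, c, s, t) := x in c < t)
     (fun x => O x /\ let '(a, c, s, t) := x in t < c)); [|apply finite_odd_quads| |].
    2: { intros [[[a c] s] t]; assert (t <> c <-> c < t \/ t < c) by lia; tauto. }
    2: { intros [[[a c] s] t]; lia. }
    rewrite -(wsum_bij (fun x => O x /\ let '(a, c, s, t) := x in c < t)
      (fun x => O x /\ let '(a, c, s, t) := x in t < c)
      (fun x => let '(a, c, s, t) := x in (s, t, a, c)) (fun x => let '(a, c, s, t) := x in (s, t, a, c))
      (fun x => let '(a, c, s, t) := x in cos4 (a + s))).
    2: apply finite_odd_quads.
    2: { intros [[[a c] s] t] [H H']; unfold O in *; quads; f_equal; lia. }
    2: { intros [[[a c] s] t] [H H']; unfold O in *; quads. }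
    rewrite (wsum_bij (fun x => O x /\ let '(a, c, s, t) := x in c < t)
      (fun x => E x /\ let '(a, c, s, t) := x in s < a)
      (fun x => let '(a, c, s, t) := x in (a + s, c, s, t - c))
      (fun x => let '(a, c, s, t) := x in (a - s, c, s, t + c))
      _ (fun x => let '(a, c, s, t) := x in cos4 a)).
    2: apply finite_odd_quads.
    2: { intros [[[a c] s] t] [H H']; unfold O, E in *; quads. }
    2: { intros [[[a c] s] t] [H H']; unfold O, E in *; quads. }
    unfold Y'; ring. }
assert (HY : Y' = - Y).
{ unfold Y; rewrite (_ : forall x, - x = -1 * x); [|intros; ring]; rewrite -wsum_scale.
  apply (wsum_bij _ _ (fun x => let '(a, c, s, t) := x in (t, s, c, a))
    (fun x => let '(a, c, s, t) := x in (t, s, c, a))).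
  - apply finite_even_quads.
  - intros [[[a c] s] t] [H H']; pose proof (even_quads_mod4 N a c s t HN H).
    unfold E in *; quads; rewrite (cos4_shift a t); lia.
  - intros [[[a c] s] t] [H H']; unfold E in *; quads. }
assert (HZ : wsum E (fun x => let '(a, c, s, t) := x in cos4 a) = 0).
{ assert (H : wsum E (fun x => let '(a, c, s, t) := x in cos4 a)
    = -1 * wsum E (fun x => let '(a, c, s, t) := x in cos4 a)); [|lia].
  rewrite -wsum_scale.
  apply (wsum_bij _ _ (fun x => let '(a, c, s, t) := x in (t, s, c, a))
    (fun x => let '(a, c, s, t) := x in (t, s, c, a))).
  - apply finite_even_quads0.
  - intros [[[a c] s] t] H; pose proof (even_quads_mod4 N a c s t HN H).
    unfold E in *; quads; rewrite (cos4_shift a t); lia.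
  - intros [[[a c] s] t] H; unfold E in *; quads. }
assert (HL : Y + L = 0).
{ rewrite -HZ (wsum_split E (fun x => E x /\ let '(a, c, s, t) := x in c < t)
     (fun x => E x /\ let '(a, c, s, t) := x in t < c)); [|apply finite_even_quads0| |].
  2: { intros [[[a c] s] t]; unfold E, even_quads; split; [|tauto].
       intros H; assert (c < t \/ t < c) by lia; tauto. }
  2: { intros [[[a c] s] t]; lia. }
  f_equal; symmetry.
  apply (wsum_bij _ _ (fun x => let '(a, c, s, t) := x in (a, c - t, s + a, t))
    (fun x => let '(a, c, s, t) := x in (a, c + t, s - a, t))).
  - apply finite_even_quads.
  - intros [[[a c] s] t] [H H']; unfold E in *; quads.
  - intros [[[a c] s] t] [H H']; unfold E in *; quads. }
assert (HL' : Y' + L = 0).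
{ rewrite -HZ (wsum_split E (fun x => E x /\ let '(a, c, s, t) := x in s < a)
     (fun x => E x /\ let '(a, c, s, t) := x in a < s)); [reflexivity|apply finite_even_quads0| |].
  - intros [[[a c] s] t]; unfold E, even_quads; split; [|tauto].
    intros H; assert (s < a \/ a < s) by lia; tauto.
  - intros [[[a c] s] t]; lia. }
lia.
Qed.

(** * Sums of two squares *)

Lemma square_mod8 x : (x mod 2 = 0 /\ (x * x) mod 4 = 0) \/ (x mod 2 = 1 /\ (x * x) mod 8 = 1).
Proof.
assert (x = 2 * (x / 2) \/ x = 2 * (x / 2) + 1) as [E|E] by lia.
- left; split; [lia|]; rewrite E; generalize (x / 2); intros k.
  replace (2 * k * (2 * k)) with (k * k * 4) by ring; apply Z_mod_mult.
- right; split; [lia|]; rewrite E; generalize (x / 2); intros k.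
  assert (k = 2 * (k / 2) \/ k = 2 * (k / 2) + 1) as [F|F] by lia; rewrite F; generalize (k / 2); intros j.
  + replace ((2 * (2 * j) + 1) * (2 * (2 * j) + 1)) with (1 + (2 * j * j + j) * 8) by ring.
    rewrite Z_mod_plus_full; reflexivity.
  + replace ((2 * (2 * j + 1) + 1) * (2 * (2 * j + 1) + 1)) with (1 + (2 * j * j + 3 * j + 1) * 8) by ring.
    rewrite Z_mod_plus_full; reflexivity.
Qed.

(** * Descent for divisors congruent to 3 modulo 4 *)

Lemma gcd_one_bezout x y : Z.gcd x y = 1 -> exists a b, a * x + b * y = 1.
Proof.
intros H; destruct (Zis_gcd_bezout x y _ (Zgcd_is_gcd x y)) as [a b Hab].
exists a, b; congruence.
Qed.

Lemma divide_gcd_reduce x y : Z.gcd x y <> 0 ->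
  exists x1 y1, x = Z.gcd x y * x1 /\ y = Z.gcd x y * y1 /\ Z.gcd x1 y1 = 1.
Proof.
intros H.
destruct (Z.gcd_divide_l x y) as [a Ha], (Z.gcd_divide_r x y) as [b Hb].
exists a, b; repeat split; try lia.
destruct (Zis_gcd_bezout x y _ (Zgcd_is_gcd x y)) as [s t Hst].
apply Zgcd_1_rel_prime, bezout_rel_prime, (Bezout_intro _ _ _ s t).
apply (Z.mul_reg_r _ _ (Z.gcd x y) H).
revert Ha Hb Hst; generalize (Z.gcd x y); intros g -> -> Hst; lia.
Qed.

(** As [x, y] are not both even, [m k] is 1 modulo 4 or 2 modulo 8. The cofactor, halved in the
    second case, is again 3 modulo 4, so the descent can continue with it, prime or not. *)
Lemma sum_coprime_squares_mod4 x y m k : Z.gcd x y = 1 -> x * x + y * y = m * k -> m mod 4 = 3 ->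
  0 < k -> exists k', (k = k' \/ k = 2 * k') /\ k' mod 4 = 3.
Proof.
intros Hg H Hm Hk.
destruct (gcd_one_bezout x y Hg) as (a & b & Hab).
assert (Hmk : (m * k) mod 8 = ((m mod 8) * (k mod 8)) mod 8) by (apply Zmult_mod).
rewrite -H in Hmk.
assert (Hm8 : m mod 8 = 3 \/ m mod 8 = 7) by lia.
assert (Hk8 : k mod 8 = 0 \/ k mod 8 = 1 \/ k mod 8 = 2 \/ k mod 8 = 3 \/ k mod 8 = 4 \/ k mod 8 = 5
  \/ k mod 8 = 6 \/ k mod 8 = 7) by lia.
destruct (square_mod8 x) as [[Hx Hx']|[Hx Hx']], (square_mod8 y) as [[Hy Hy']|[Hy Hy']].
- exfalso; assert (Ex : x = 2 * (x / 2)) by lia; assert (Ey : y = 2 * (y / 2)) by lia.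
  rewrite Ex Ey in Hab; revert Hab; generalize (x / 2) (y / 2); clear; intros; lia.
- exists k; split; [auto|]; clear H Hab Hg; generalize dependent (x * x); generalize dependent (y * y); intros.
  destruct Hm8 as [E|E]; rewrite E in Hmk;
  destruct Hk8 as [F|[F|[F|[F|[F|[F|[F|F]]]]]]]; rewrite F in Hmk; simpl in Hmk; lia.
- exists k; split; [auto|]; clear H Hab Hg; generalize dependent (x * x); generalize dependent (y * y); intros.
  destruct Hm8 as [E|E]; rewrite E in Hmk;
  destruct Hk8 as [F|[F|[F|[F|[F|[F|[F|F]]]]]]]; rewrite F in Hmk; simpl in Hmk; lia.
- exists (k / 2); clear H Hab Hg; generalize dependent (x * x); generalize dependent (y * y); intros.
  destruct Hm8 as [E|E]; rewrite E in Hmk;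
  destruct Hk8 as [F|[F|[F|[F|[F|[F|[F|F]]]]]]]; rewrite F in Hmk; simpl in Hmk; lia.
Qed.

Lemma square_le_scaled g x : g <> 0 -> x * x <= g * x * (g * x).
Proof.
intros Hg; assert (1 <= g * g) by nia.
pose proof (Z.square_nonneg x); nia.
Qed.

(* Fermat's descent: reducing [x] and [y] modulo [m] yields a smaller such divisor. *)
Lemma not_divide_sum_coprime_squares (n : nat) : forall m x y, 0 < m <= Z.of_nat n ->
  m mod 4 = 3 -> Z.gcd x y = 1 -> ~ (m | x * x + y * y).
Proof.
induction n as [|n IH]; intros m x y Hmn Hm Hg [k0 Hk0]; [lia|].
assert (Hc : forall z, exists k z', z = m * k + z' /\ - m < 2 * z' < m).
{ intros z; destruct (Z_lt_ge_dec (2 * (z mod m)) m).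
  - exists (z / m), (z mod m); pose proof (Z.div_mod z m); pose proof (Z.mod_pos_bound z m); lia.
  - exists (z / m + 1), (z mod m - m); pose proof (Z.div_mod z m); pose proof (Z.mod_pos_bound z m); lia. }
destruct (Hc x) as (kx & x' & Ex & Bx), (Hc y) as (ky & y' & Ey & By).
destruct (gcd_one_bezout x y Hg) as (a & b & Hab).
assert (Hg0 : Z.gcd x' y' <> 0).
{ intros E; pose proof (Z.gcd_eq_0_l _ _ E) as X0; pose proof (Z.gcd_eq_0_r _ _ E) as Y0.
  rewrite Ex Ey X0 Y0 in Hab.
  assert (Hm1 : m * (a * kx + b * ky) = 1) by lia.
  apply Z.mul_eq_1 in Hm1; lia. }
destruct (divide_gcd_reduce x' y' Hg0) as (x1 & y1 & Ex1 & Ey1 & Hg1).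
set (g := Z.gcd x' y') in *.
(* A common divisor of [m] and [g] would divide the coprime [x] and [y]; hence [g^2] can be
   cancelled. *)
assert (Hcop : rel_prime m (g * g)).
{ apply rel_prime_mult; apply bezout_rel_prime;
  apply (Bezout_intro _ _ _ (a * kx + b * ky) (a * x1 + b * y1));
  rewrite -Hab Ex Ey Ex1 Ey1; ring. }
assert (Hd : (m | x1 * x1 + y1 * y1)).
{ apply (Gauss m (g * g)); [|exact Hcop].
  exists (k0 - m * kx * kx - 2 * kx * x' - m * ky * ky - 2 * ky * y').
  transitivity (x' * x' + y' * y'); [rewrite Ex1 Ey1; ring|].
  rewrite Ex Ey in Hk0; lia. }
destruct Hd as [k Hk].
assert (Hkb : 0 < k /\ 2 * k < m).
{ assert (Hx1 : x1 * x1 <= x' * x') by (rewrite {1 2}Ex1; now apply square_le_scaled).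
  assert (Hy1 : y1 * y1 <= y' * y') by (rewrite {1 2}Ey1; now apply square_le_scaled).
  assert (Hx2 : 4 * (x' * x') < m * m) by (clear -Bx; nia).
  assert (Hy2 : 4 * (y' * y') < m * m) by (clear -By; nia).
  assert (Hpos : 0 < x1 * x1 + y1 * y1).
  { pose proof (Z.square_nonneg x1); pose proof (Z.square_nonneg y1).
    assert (x1 <> 0 \/ y1 <> 0) as [Hn|Hn].
    { destruct (Z.eq_dec x1 0) as [E1|]; [right|now left]; intros E2.
      rewrite E1 E2 in Hg1; discriminate. }
    - assert (0 < x1 * x1) by (clear -Hn; nia); lia.
    - assert (0 < y1 * y1) by (clear -Hn; nia); lia. }
  clear -Hx1 Hy1 Hx2 Hy2 Hpos Hk Hmn.
  assert (0 < k) by nia.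
  assert (2 * (k * m) < m * m) by lia. nia. }
destruct (sum_coprime_squares_mod4 x1 y1 m k Hg1) as (k' & Ek' & Hk'); [lia|exact Hm|lia|].
apply (IH k' x1 y1); [lia|exact Hk'|exact Hg1|].
destruct Ek' as [E|E]; [exists m|exists (2 * m)]; rewrite Hk E; ring.
Qed.

Lemma prime3_divide_sum_squares p x y : Znumtheory.prime p -> p mod 4 = 3 -> (p | x * x + y * y) ->
  (p | x) /\ (p | y).
Proof.
intros Hp Hm Hd.
assert (Hp0 : 0 < p) by (destruct Hp; lia).
assert (Hx : (p | x)).
{ apply NNPP; intros Hx.
  assert (Hg0 : Z.gcd x y <> 0).
  { intros E; apply Z.gcd_eq_0_l in E; apply Hx; subst x; apply Z.divide_0_r. }
  destruct (divide_gcd_reduce x y Hg0) as (x1 & y1 & Ex1 & Ey1 & Hg1).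
  apply (not_divide_sum_coprime_squares (Z.to_nat p) p x1 y1); auto; [lia|].
  pose proof (Z.gcd_divide_l x y) as Hgx; revert Ex1 Ey1 Hgx; generalize (Z.gcd x y).
  intros g Ex1 Ey1 Hgx.
  assert (Hpg : (p | g * g * (x1 * x1 + y1 * y1))).
  { replace (g * g * (x1 * x1 + y1 * y1)) with (x * x + y * y); [exact Hd|].
    rewrite Ex1 Ey1; ring. }
  apply prime_mult in Hpg; auto; destruct Hpg as [Hpg|]; auto.
  destruct Hx; apply (Z.divide_trans _ g); [|exact Hgx].
  apply prime_mult in Hpg; tauto. }
split; auto.
assert (Hy : (p | y * y)).
{ replace (y * y) with (x * x + y * y - x * x) by ring.
  apply Z.divide_sub_r; auto; apply Z.divide_mul_l; auto. }
apply prime_mult in Hy; tauto.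
Qed.

(** * Involutions and primes congruent to 1 modulo 4 *)

Definition lex3 (s t : Z * Z * Z) : Prop :=
  let '(x, y, z) := s in let '(x', y', z') := t in x < x' \/ x = x' /\ (y < y' \/ y = y' /\ z < z').

(** The points moved by [f] are lowered or raised in the lexicographic order, and [f] exchanges the
    two classes. *)
Lemma involution_parity (P : Z * Z * Z -> Prop) (f : Z * Z * Z -> Z * Z * Z) :
  finite P -> (forall t, P t -> P (f t) /\ f (f t) = t) ->
  exists k, setcard P = setcard (fun t => P t /\ f t = t) + 2 * k.
Proof.
intros HP Hf.
exists (setcard (fun t => P t /\ lex3 (f t) t)).
unfold setcard.
rewrite (wsum_split P (fun t => P t /\ f t = t) (fun t => P t /\ f t <> t)); auto; try tauto.
2: { intros t; destruct (classic (f t = t)); tauto. }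
f_equal.
rewrite (wsum_split _ (fun t => P t /\ lex3 (f t) t) (fun t => P t /\ lex3 t (f t))).
- rewrite -(wsum_bij (fun t => P t /\ lex3 (f t) t) (fun t => P t /\ lex3 t (f t)) f f (fun _ => 1)); [ring| | |].
  + apply (finite_sub _ P HP); tauto.
  + intros t [Ht Hl]; destruct (Hf t Ht) as [H1 H2]; rewrite H2; auto.
  + intros t [Ht Hl]; destruct (Hf t Ht) as [H1 H2]; rewrite H2; auto.
- apply (finite_sub _ P HP); tauto.
- intros t; enough (f t <> t <-> lex3 (f t) t \/ lex3 t (f t)) by tauto.
  destruct (f t) as [[x y] z], t as [[x' y'] z']; unfold lex3; split.
  + intros H; assert (x <> x' \/ y <> y' \/ z <> z').
    { apply NNPP; intros N; apply H; repeat f_equal; lia. }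
    lia.
  + intros H E; inversion E; subst; lia.
- intros t; destruct (f t) as [[x y] z], t as [[x' y'] z']; unfold lex3; lia.
Qed.

Definition zagier (t : Z * Z * Z) : Z * Z * Z :=
  let '(x, y, z) := t in
  if x <? y - z then (x + 2 * z, z, y - x - z)
  else if x <? 2 * y then (2 * y - x, y, x - y + z)
  else (x - 2 * y, x - y + z, y).

(* Zagier's one-sentence proof. *)
Lemma prime1_sum_squares p : Znumtheory.prime p -> p mod 4 = 1 -> exists A B, A * A + B * B = p.
Proof.
intros Hp Hm.
assert (Hp1 : 1 < p) by (destruct Hp; lia).
set (P := fun t : Z * Z * Z => let '(x, y, z) := t in
  0 < x /\ 0 < y /\ 0 < z /\ x * x + 4 * y * z = p).
assert (HP : finite P).
{ apply (finite_Z3 _ p); intros x y z (Hx & Hy & Hz & H).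
  assert (x <= p /\ y <= p /\ z <= p) by (clear -Hx Hy Hz H; nia); lia. }
assert (Hsq : forall k, k * k <> p).
{ intros k E; destruct (prime_mult p Hp k k) as [[j Hj]|[j Hj]]; [exists 1; lia| |];
  rewrite Hj in E; assert (H1 : p * (j * j) = 1) by (apply (Z.mul_reg_r _ _ p); lia);
  apply Z.mul_eq_1 in H1; lia. }
assert (Hz : forall t, P t -> P (zagier t) /\ zagier (zagier t) = t).
{ intros [[x y] z] (H1 & H2 & H3 & H4).
  (* On the boundaries between the cases [p] would be the square [(y + z)^2] or a multiple of 4. *)
  assert (Hne1 : x <> y - z).
  { intros E; apply (Hsq (y + z)); rewrite -H4 E; ring. }
  assert (Hne2 : x <> 2 * y).
  { intros E; rewrite E in H4; assert (4 * (y * y + y * z) = p) by lia.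
    generalize dependent (y * y + y * z); intros; lia. }
  unfold zagier.
  destruct (Z.ltb_spec x (y - z)); [|destruct (Z.ltb_spec x (2 * y))].
  - split; [unfold P; repeat split; lia|].
    destruct (Z.ltb_spec (x + 2 * z) (z - (y - x - z))); [lia|].
    destruct (Z.ltb_spec (x + 2 * z) (2 * z)); [lia|]; repeat f_equal; lia.
  - split; [unfold P; repeat split; lia|].
    destruct (Z.ltb_spec (2 * y - x) (y - (x - y + z))); [lia|].
    destruct (Z.ltb_spec (2 * y - x) (2 * y)); [|lia]; repeat f_equal; lia.
  - split; [unfold P; repeat split; lia|].
    destruct (Z.ltb_spec (x - 2 * y) (x - y + z - y)); [|lia]; repeat f_equal; lia. }
destruct (involution_parity P zagier HP Hz) as [k1 Hk1].
assert (Hfix : setcard (fun t => P t /\ zagier t = t) = 1).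
{ apply (wsum_single _ (fun _ => 1) (1, 1, p / 4)); intros [[x y] z]; split.
  - intros [(H1 & H2 & H3 & H4) E].
    unfold zagier in E; destruct (Z.ltb_spec x (y - z)); [inversion E; lia|].
    destruct (Z.ltb_spec x (2 * y)); [|inversion E; lia].
    inversion E.
    assert (Exy : x = y) by lia; subst y.
    assert (Hx : (x | p)) by (exists (x + 4 * z); lia).
    apply prime_divisors in Hx; auto.
    assert (x = 1).
    { destruct Hx as [Hx|[Hx|[Hx|Hx]]]; try lia; subst x; clear -H4 H3 Hp1; nia. }
    subst x; assert (Ez : z = p / 4) by (clear -H4; lia); rewrite -Ez; reflexivity.
  - intros E; inversion E; subst; split; [unfold P; repeat split; lia|].
    unfold zagier; destruct (Z.ltb_spec 1 (1 - p / 4)); [lia|].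
    destruct (Z.ltb_spec 1 (2 * 1)); [|lia]; repeat f_equal; lia. }
(* The number of triples is odd, so exchanging [y] and [z] also fixes one, and there
   [p = x^2 + (2y)^2]. *)
destruct (involution_parity P (fun t => let '(x, y, z) := t in (x, z, y)) HP) as [k2 Hk2].
{ intros [[x y] z] (H1 & H2 & H3 & H4); split; [unfold P; repeat split; lia|reflexivity]. }
destruct (setcard_inhabited (fun t => P t /\ (let '(x, y, z) := t in (x, z, y)) = t)) as [[[x y] z] [Ht E]].
{ assert (0 <= setcard (fun t => P t /\ (let '(x, y, z) := t in (x, z, y)) = t)).
  { rewrite setcard_length; lia. }
  lia. }
exists x, (2 * y); destruct Ht as (_ & _ & _ & H); injection E as E1 E2; rewrite -H E1; ring.
Qed.

(** * Jacobi's two-squares theorem for odd numbers *)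

Definition sq2 (k u : Z) (t : Z * Z) : Prop := k * (fst t * fst t + snd t * snd t) = u.
(** The factor [k] lets [sq2 p u] and [divs p u] stand for the sets of [u / p], empty unless [p]
    divides [u]. *)
Definition divs (k u : Z) (t : Z * Z) : Prop := 0 < fst t /\ 0 < snd t /\ k * (fst t * snd t) = u.
Definition chi1 (t : Z * Z) : Z := chi (fst t).

Lemma finite_sq2 k u : 0 < k -> finite (sq2 k u).
Proof.
intros Hk; apply (finite_Z2 _ (Z.abs u)); intros x y H; unfold sq2 in H; cbn [fst snd] in H.
pose proof (abs_le_square x); pose proof (abs_le_square y).
assert (x * x + y * y <= u) by (clear -H Hk; pose proof (Z.square_nonneg x); pose proof (Z.square_nonneg y); nia).
lia.
Qed.

Lemma finite_divs k u : 0 < k -> finite (divs k u).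
Proof.
intros Hk; apply (finite_Z2 _ (Z.abs u)); intros x y (Hx & Hy & H); cbn [fst snd] in *.
assert (x <= x * y /\ y <= x * y) by (clear -Hx Hy; nia).
assert (x * y <= u) by (clear -H Hk Hx Hy; nia).
lia.
Qed.

Lemma chi_mul x y : chi (x * y) = chi x * chi y.
Proof.
assert (H : (x * y) mod 4 = ((x mod 4) * (y mod 4)) mod 4) by apply Zmult_mod.
unfold chi; rewrite H.
assert (x mod 4 = 0 \/ x mod 4 = 1 \/ x mod 4 = 2 \/ x mod 4 = 3) as [E|[E|[E|E]]] by lia; rewrite E;
assert (y mod 4 = 0 \/ y mod 4 = 1 \/ y mod 4 = 2 \/ y mod 4 = 3) as [F|[F|[F|F]]] by lia; rewrite F;
reflexivity.
Qed.

Lemma wsum_inclusion_exclusion {A : Type} (P Q R : A -> Prop) w :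
  finite P -> (forall x, P x -> Q x \/ R x) ->
  wsum P w = wsum (fun x => P x /\ Q x) w + wsum (fun x => P x /\ R x) w
             - wsum (fun x => P x /\ Q x /\ R x) w.
Proof.
intros HP H.
rewrite (wsum_split P (fun x => P x /\ Q x) (fun x => P x /\ R x /\ ~ Q x)); auto.
- rewrite (wsum_split (fun x => P x /\ R x) (fun x => P x /\ Q x /\ R x) (fun x => P x /\ R x /\ ~ Q x)).
  + ring.
  + apply (finite_sub _ P HP); tauto.
  + intros x; destruct (classic (Q x)); tauto.
  + tauto.
- intros x; specialize (H x); destruct (classic (Q x)); tauto.
- tauto.
Qed.

Lemma div_eq p k x : 0 < p -> x = p * k -> x / p = k.
Proof. intros Hp ->; rewrite Z.mul_comm Z_div_mult_full; lia. Qed.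

(** In [d e = p u] the prime divides [d] or [e]: inclusion and exclusion, with [chi]
    multiplicative. *)
Lemma sum_chi_divs_prime p u : Znumtheory.prime p -> 0 < u ->
  wsum (divs 1 (p * u)) chi1 = (1 + chi p) * wsum (divs 1 u) chi1 - chi p * wsum (divs p u) chi1.
Proof.
intros Hp Hu.
assert (Hp0 : 0 < p) by (destruct Hp; lia).
rewrite (wsum_inclusion_exclusion _ (fun t => (p | fst t)) (fun t => (p | snd t))).
2: apply finite_divs; lia.
2: { intros [d e] (_ & _ & H); cbn [fst snd] in *; apply prime_mult; auto; exists u; lia. }
rewrite (wsum_bij (fun x => divs 1 (p * u) x /\ (p | fst x)) (divs 1 u)
  (fun t => (fst t / p, snd t)) (fun t => (p * fst t, snd t)) _ (fun t => chi p * chi1 t)).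
2: { apply (finite_sub _ (divs 1 (p * u))); [apply finite_divs; lia|tauto]. }
2: { intros [d e] [(H1 & H2 & H3) [k Hk]]; unfold divs, chi1 in *; cbn [fst snd] in *.
     rewrite (div_eq p k d); [|lia|lia].
     assert (0 < k) by (clear -H1 Hk Hp0; nia).
     assert (k * e = u) by (clear -H3 Hk Hp0; rewrite Hk in H3; apply (Z.mul_reg_l _ _ p); lia).
     split; [repeat split; lia|split; [f_equal; lia|]].
     rewrite Hk Z.mul_comm; apply chi_mul. }
2: { intros [d e] (H1 & H2 & H3); unfold divs in *; cbn [fst snd] in *.
     split; [split; [repeat split; lia|exists d; lia]|f_equal; apply div_eq; lia]. }
rewrite (wsum_bij (fun x => divs 1 (p * u) x /\ (p | snd x)) (divs 1 u)
  (fun t => (fst t, snd t / p)) (fun t => (fst t, p * snd t)) _ chi1).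
2: { apply (finite_sub _ (divs 1 (p * u))); [apply finite_divs; lia|tauto]. }
2: { intros [d e] [(H1 & H2 & H3) [k Hk]]; unfold divs, chi1 in *; cbn [fst snd] in *.
     rewrite (div_eq p k e); [|lia|lia].
     assert (0 < k) by (clear -H2 Hk Hp0; nia).
     assert (d * k = u) by (clear -H3 Hk Hp0; rewrite Hk in H3; apply (Z.mul_reg_l _ _ p); lia).
     split; [repeat split; lia|split; [f_equal; lia|reflexivity]]. }
2: { intros [d e] (H1 & H2 & H3); unfold divs in *; cbn [fst snd] in *.
     split; [split; [repeat split; lia|exists e; lia]|f_equal; apply div_eq; lia]. }
rewrite (wsum_bij (fun x => divs 1 (p * u) x /\ (p | fst x) /\ (p | snd x)) (divs p u)
  (fun t => (fst t / p, snd t / p)) (fun t => (p * fst t, p * snd t)) _ (fun t => chi p * chi1 t)).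
2: { apply (finite_sub _ (divs 1 (p * u))); [apply finite_divs; lia|tauto]. }
2: { intros [d e] [(H1 & H2 & H3) [[k Hk] [j Hj]]]; unfold divs, chi1 in *; cbn [fst snd] in *.
     rewrite (div_eq p k d) ?(div_eq p j e); [|lia|lia|lia|lia].
     assert (0 < k) by (clear -H1 Hk Hp0; nia).
     assert (0 < j) by (clear -H2 Hj Hp0; nia).
     assert (p * (k * j) = u)
       by (clear -H3 Hk Hj Hp0; rewrite Hk Hj in H3; apply (Z.mul_reg_l _ _ p); lia).
     split; [repeat split; lia|split; [f_equal; lia|]].
     rewrite Hk Z.mul_comm; apply chi_mul. }
2: { intros [d e] (H1 & H2 & H3); unfold divs in *; cbn [fst snd] in *.
     assert (1 * (p * d * (p * e)) = p * u) by (rewrite -H3; ring).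
     split; [|f_equal; apply div_eq; lia].
     split; [repeat split; lia|split; [exists d; lia|exists e; lia]]. }
rewrite !wsum_scale; ring.
Qed.

Lemma card_sq2_prime3 p u : Znumtheory.prime p -> p mod 4 = 3 -> setcard (sq2 1 (p * u)) = setcard (sq2 p u).
Proof.
intros Hp Hm.
assert (Hp0 : 0 < p) by (destruct Hp; lia).
apply (wsum_bij _ _ (fun t => (fst t / p, snd t / p)) (fun t => (p * fst t, p * snd t))).
- apply finite_sq2; lia.
- intros [x y] H; unfold sq2 in *; cbn [fst snd] in *.
  destruct (prime3_divide_sum_squares p x y Hp Hm) as [[k Hk] [j Hj]]; [exists u; lia|].
  rewrite (div_eq p k x) ?(div_eq p j y); [|lia|lia|lia|lia].
  repeat split; [|f_equal; lia].
  rewrite Hk Hj in H; apply (Z.mul_reg_l _ _ p); lia.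
- intros [x y] H; unfold sq2 in *; cbn [fst snd] in *.
  split; [rewrite -H; ring|f_equal; apply div_eq; lia].
Qed.

(* Multiplication by the two Gaussian primes above [p]. *)
Lemma card_sq2_prime1 p u : Znumtheory.prime p -> p mod 4 = 1 ->
  setcard (sq2 1 (p * u)) = 2 * setcard (sq2 1 u) - setcard (sq2 p u).
Proof.
intros Hp Hm.
assert (Hp0 : 1 < p) by (destruct Hp; lia).
destruct (prime1_sum_squares p Hp Hm) as (A & B & HAB).
assert (HA : ~ (p | A) /\ ~ (p | B)).
{ assert (Hsmall : forall C D, C * C + D * D = p -> ~ (p | C)).
  { intros C D HCD [k Hk]; pose proof (Z.square_nonneg D).
    destruct (Z.eq_dec k 0) as [->|Hk0].
    - assert (HC : C = 0) by lia; rewrite HC in HCD.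
      destruct (prime_mult p Hp D D) as [[j Hj]|[j Hj]]; [exists 1; lia| |];
      rewrite Hj in HCD; assert (H1 : p * (j * j) = 1) by (apply (Z.mul_reg_r _ _ p); lia);
      apply Z.mul_eq_1 in H1; lia.
    - assert (1 <= k * k) by (clear -Hk0; nia).
      assert (p * p <= C * C) by (rewrite Hk; clear -H0 Hp0; nia).
      assert (p <= 1) by (clear -HCD H H1 Hp0; nia). lia. }
  split; [apply (Hsmall A B)|apply (Hsmall B A)]; lia. }
assert (Hdvd : forall x y C D, C * C + D * D = p -> x * x + y * y = p * u -> (p | x * C + y * D) ->
   (p | y * C - x * D)).
{ intros x y C D HCD H [k Hk].
  assert (Hsq : (p | (y * C - x * D) * (y * C - x * D))).
  { exists (p * u - p * (k * k)).
    replace ((y * C - x * D) * (y * C - x * D)) with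
      ((x * x + y * y) * (C * C + D * D) - (x * C + y * D) * (x * C + y * D)) by ring.
    rewrite H HCD Hk; ring. }
  apply prime_mult in Hsq; tauto. }
assert (Hbij : forall C D, C * C + D * D = p ->
  setcard (fun t => sq2 1 (p * u) t /\ (p | fst t * C + snd t * D)) = setcard (sq2 1 u)).
{ intros C D HCD.
  apply (wsum_bij _ _ (fun t => ((fst t * C + snd t * D) / p, (snd t * C - fst t * D) / p))
    (fun t => (C * fst t - D * snd t, D * fst t + C * snd t))).
  - apply (finite_sub _ (sq2 1 (p * u))); [apply finite_sq2; lia|tauto].
  - intros [x y] [H Hd]; unfold sq2 in *; cbn [fst snd] in *.
    destruct (Hdvd x y C D HCD) as [j Hj]; [lia|exact Hd|]; destruct Hd as [k Hk].
    rewrite (div_eq p k (x * C + y * D)) ?(div_eq p j (y * C - x * D)); [|lia|lia|lia|lia].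
    assert (Ex : C * k - D * j = x).
    { apply (Z.mul_reg_r _ _ p); [lia|].
      transitivity (C * (k * p) - D * (j * p)); [ring|rewrite -Hk -Hj -HCD; ring]. }
    assert (Ey : D * k + C * j = y).
    { apply (Z.mul_reg_r _ _ p); [lia|].
      transitivity (D * (k * p) + C * (j * p)); [ring|rewrite -Hk -Hj -HCD; ring]. }
    repeat split; [|now rewrite Ex Ey].
    apply (Z.mul_reg_l _ _ p); [lia|].
    rewrite -H -Ex -Ey -HCD; ring.
  - intros [x y] H; unfold sq2 in *; cbn [fst snd] in *.
    repeat split.
    + rewrite -H -HCD; ring.
    + exists x; rewrite -HCD; ring.
    + f_equal; apply div_eq; [lia|rewrite -HCD; ring|lia|rewrite -HCD; ring]. }
unfold setcard at 1; rewrite (wsum_inclusion_exclusion _ (fun t => (p | fst t * A + snd t * B))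
  (fun t => (p | fst t * A + snd t * - B))).
2: apply finite_sq2; lia.
(* [(x A + y B) (x A - y B) = x^2 p - B^2 p u], so [p] divides one of the factors. *)
2: { intros [x y] H; unfold sq2 in H; cbn [fst snd] in *; apply prime_mult; auto.
     exists (x * x - B * B * u).
     transitivity (x * x * (A * A + B * B) - B * B * (1 * (x * x + y * y))); [ring|].
     rewrite HAB H; ring. }
fold (setcard (fun x => sq2 1 (p * u) x /\ (p | fst x * A + snd x * B))).
fold (setcard (fun x => sq2 1 (p * u) x /\ (p | fst x * A + snd x * - B))).
rewrite !Hbij; [|lia|lia].
enough (E : wsum (fun x => sq2 1 (p * u) x /\ (p | fst x * A + snd x * B) /\ (p | fst x * A + snd x * - B))
  (fun _ => 1) = setcard (sq2 p u)) by lia.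
apply (wsum_bij _ _ (fun t => (fst t / p, snd t / p)) (fun t => (p * fst t, p * snd t))).
- apply (finite_sub _ (sq2 1 (p * u))); [apply finite_sq2; lia|tauto].
- intros [x y] [H [[k Hk] [j Hj]]]; unfold sq2 in *; cbn [fst snd] in *.
  assert (H2 : forall z, (p | 2 * z) -> (p | z)).
  { intros z Hz; apply prime_mult in Hz; auto; destruct Hz as [Hz|]; auto.
    apply Z.divide_pos_le in Hz; lia. }
  assert (Hx : (p | x)).
  { assert (Hd : (p | x * A)) by (apply H2; exists (k + j); lia).
    apply prime_mult in Hd; tauto. }
  assert (Hy : (p | y)).
  { assert (Hd : (p | y * B)) by (apply H2; exists (k - j); lia).
    apply prime_mult in Hd; tauto. }
  destruct Hx as [x1 Hx], Hy as [y1 Hy].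
  rewrite (div_eq p x1 x) ?(div_eq p y1 y); [|lia|lia|lia|lia].
  repeat split; [|f_equal; lia].
  rewrite Hx Hy in H; apply (Z.mul_reg_l _ _ p); lia.
- intros [x y] H; unfold sq2 in *; cbn [fst snd] in *.
  repeat split.
  + rewrite -H; ring.
  + exists (x * A + y * B); ring.
  + exists (x * A + y * - B); ring.
  + f_equal; apply div_eq; lia.
Qed.

Lemma prime_factor (n : nat) : forall u, 1 < u <= Z.of_nat n -> exists p k, Znumtheory.prime p /\ u = p * k.
Proof.
induction n as [|n IH]; intros u Hu; [lia|].
destruct (prime_dec u) as [Hp|Hp]; [exists u, 1; split; [exact Hp|ring]|].
destruct (not_prime_divide u) as [d [Hd [k Hk]]]; [lia|exact Hp|].
destruct (IH d) as (p & j & Hp' & Hj); [lia|].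
exists p, (k * j); split; [exact Hp'|]; rewrite Hk Hj; ring.
Qed.

(** For every odd prime [p] both sides satisfy [f(p k) = (1 + chi p) f(k) - chi p f(k/p)], where the
    last term is 0 unless [p] divides [k]. *)
Lemma card_sq2 (n : nat) : forall u, 0 < u <= Z.of_nat n -> u mod 2 = 1 ->
  setcard (sq2 1 u) = 4 * wsum (divs 1 u) chi1.
Proof.
induction n as [|n IH]; intros u Hu Ho; [lia|].
destruct (Z.eq_dec u 1) as [->|Hu1].
{ rewrite (wsum_single (divs 1 1) _ (1, 1)).
  - unfold setcard; rewrite (wsum_enum (sq2 1 1) _ [:: (1, 0); (-1, 0); (0, 1); (0, -1)]); [reflexivity| |].
    + repeat constructor; simpl; intuition; discriminate.
    + intros [x y]; unfold sq2; cbn [In fst snd]; split.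
      * intros [E|[E|[E|[E|[]]]]]; inversion E; reflexivity.
      * intros H.
        assert (-1 <= x <= 1 /\ -1 <= y <= 1).
        { pose proof (abs_le_square x); pose proof (abs_le_square y); lia. }
        assert (Hx : x = -1 \/ x = 0 \/ x = 1) by lia; assert (Hy : y = -1 \/ y = 0 \/ y = 1) by lia.
        destruct Hx as [-> | [-> | ->]], Hy as [-> | [-> | ->]]; try discriminate; auto.
  - intros [d e]; unfold divs; cbn [fst snd]; split.
    + intros (H1 & H2 & H3); assert (E : d * e = 1) by lia; apply Z.mul_eq_1 in E as F.
      destruct F as [-> | ->]; [f_equal; lia|lia].
    + intros E; inversion E; lia. }
destruct (prime_factor (Z.to_nat u) u) as (p & k & Hp & Hk); [lia|].
assert (Hp2 : 2 <= p) by (destruct Hp; lia).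
assert (Hk0 : 0 < k < u) by (clear -Hk Hu Hp2; nia).
destruct (odd_mul p k) as [Po Ko]; [congruence|].
assert (Hsub : setcard (sq2 p k) = 4 * wsum (divs p k) chi1).
{ destruct (classic (p | k)) as [[j Hj]|Hn].
  - assert (Hj0 : 0 < j <= k) by (clear -Hj Hk0 Hp2; nia).
    destruct (odd_mul j p) as [Jo _]; [congruence|].
    transitivity (setcard (sq2 1 j)); [|rewrite IH; [|lia|exact Jo]; f_equal].
    + apply wsum_ext; auto; [apply finite_sq2; lia|].
      intros [x y]; unfold sq2; cbn [In fst snd]; split; intros H; [apply (Z.mul_reg_l _ _ p); lia|].
      rewrite Hj -H; ring.
    + symmetry; apply wsum_ext; auto; [apply finite_divs; lia|].
      intros [x y]; unfold divs; cbn [fst snd]; split; intros (H1 & H2 & H3); repeat split; auto;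
        [apply (Z.mul_reg_l _ _ p); lia|]; rewrite Hj -H3; ring.
  - unfold setcard; rewrite !wsum_empty; [reflexivity| |].
    + intros [x y] (_ & _ & H); apply Hn; exists (x * y); cbn [fst snd] in H; lia.
    + intros [x y] H; unfold sq2 in H; apply Hn; exists (x * x + y * y); cbn [fst snd] in H; lia. }
rewrite Hk sum_chi_divs_prime; [|exact Hp|lia].
assert (Hp4 : p mod 4 = 1 \/ p mod 4 = 3) by lia.
assert (HI := IH k ltac:(lia) Ko).
destruct Hp4 as [E|E].
- assert (Hc : chi p = 1) by (unfold chi; rewrite E; reflexivity).
  rewrite card_sq2_prime1; auto; rewrite Hc HI Hsub; ring.
- assert (Hc : chi p = -1) by (unfold chi; rewrite E; reflexivity).
  rewrite card_sq2_prime3; auto; rewrite Hc Hsub; ring.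
Qed.

(** * Twice an odd number is a sum of three squares *)

Definition three_squares (m : Z) (x : Z * Z * Z) : Prop :=
  let '(e, o, o') := x in
  e mod 2 = 0 /\ o mod 2 = 1 /\ o' mod 2 = 1 /\ e * e + o * o + o' * o' = 2 * m.

(* Reduced forms [a X^2 + 4 T X Y + 2 c Y^2] of determinant [2 m], modulo [Gamma_0(2)]. *)
Definition reduced_forms (m : Z) (x : Z * Z * Z) : Prop :=
  let '(a, c, T) := x in
  0 < a /\ 0 < c /\ a * c - 2 * T * T = m /\ - a < 2 * T < a /\ - c < 2 * T < c.

Definition interval (n K : Z) : Prop := - n <= K <= n.

Lemma finite_interval n : finite (interval n).
Proof. apply (finite_Z _ n); auto. Qed.

(** As [u - v] is even, one can put [u = K - T], [v = K + T]; then [a c + 2 u v = N] becomes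
    [a c - 2 T^2 = N - 2 K^2], and [|u - v|] becomes [2 |T|]. *)
Lemma sum_reduced_forms N :
  wsum (interval (2 * Z.abs N)) (fun K => setcard (reduced_forms (N - 2 * K * K)))
  = setcard (reduced_bases N).
Proof.
symmetry; unfold setcard at 1.
rewrite (wsum_fibre (reduced_bases N) (interval (2 * Z.abs N)) (fun x => let '(a, c, u, v) := x in (u + v) / 2)).
2: apply finite_reduced_bases.
2: apply finite_interval.
2: { intros [[[a c] u] v] ((Ha & Hc & _ & H1 & H2) & HN); unfold interval.
     assert (Hac : (u - v) * (u - v) < a * c).
     { rewrite -(Z.abs_square (u - v)); apply Z.mul_lt_mono_nonneg; lia. }
     assert (Hk : 2 * (a * c) + (u + v) * (u + v) - (u - v) * (u - v) = 2 * N) by (rewrite -HN; ring).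
     pose proof (Z.square_nonneg (u - v)); pose proof (abs_le_square (u + v)); lia. }
apply wsum_ext; [apply finite_interval|tauto|].
intros K _.
apply (wsum_bij _ _ (fun x => let '(a, c, u, v) := x in (a, c, (v - u) / 2))
  (fun x => let '(a, c, T) := x in (a, c, K - T, K + T))).
- apply (finite_sub _ _ (finite_reduced_bases N)); tauto.
- intros [[[a c] u] v] [((Ha & Hc & He & H1 & H2) & HN) HK].
  assert (Hu : u = K - (v - u) / 2) by lia; assert (Hv : v = K + (v - u) / 2) by lia.
  split; [|split; [rewrite -Hu -Hv|]; reflexivity].
  repeat split; try lia.
- intros [[a c] T] (Ha & Hc & H & H1 & H2); unfold reduced_bases, reduced.
  split; [repeat split; lia|].
  repeat f_equal; lia.
Qed.

Definition even_odd_squares (u : Z) (t : Z * Z) : Prop :=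
  fst t mod 2 = 0 /\ snd t mod 2 = 1 /\ fst t * fst t + snd t * snd t = u.

Lemma finite_even_odd_squares u : finite (even_odd_squares u).
Proof.
apply (finite_sub _ _ (finite_sq2 1 u ltac:(lia))).
intros [x y] (_ & _ & H); unfold sq2; cbn [fst snd] in *; lia.
Qed.

Lemma square_mod2 x : (x * x) mod 2 = x mod 2.
Proof. destruct (square_mod8 x) as [[H H']|[H H']]; generalize dependent (x * x); intros; lia. Qed.

Lemma card_even_odd_squares u : 0 <= u ->
  setcard (even_odd_squares u) = if u mod 2 =? 1 then 2 * wsum (divs 1 u) chi1 else 0.
Proof.
intros Hu; destruct (Z.eqb_spec (u mod 2) 1) as [Ho|He].
- assert (H : setcard (sq2 1 u) = 4 * wsum (divs 1 u) chi1) by (apply (card_sq2 (Z.to_nat u)); lia).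
  enough (setcard (sq2 1 u) = 2 * setcard (even_odd_squares u)) by lia.
  unfold setcard.
  rewrite (wsum_split (sq2 1 u) (even_odd_squares u) (fun t => even_odd_squares u (snd t, fst t))).
  + rewrite (wsum_bij (fun t => even_odd_squares u (snd t, fst t)) (even_odd_squares u)
      (fun t => (snd t, fst t)) (fun t => (snd t, fst t)) _ (fun _ => 1)); [ring| | |].
    * apply (finite_sub _ _ (finite_sq2 1 u ltac:(lia))).
      intros [x y] (_ & _ & H'); unfold sq2; cbn [fst snd] in *; lia.
    * intros [x y] H'; cbn [fst snd] in *; auto.
    * intros [x y] H'; cbn [fst snd] in *; auto.
  + apply finite_sq2; lia.
  + intros [x y]; unfold sq2, even_odd_squares; cbn [fst snd].
    pose proof (square_mod2 x); pose proof (square_mod2 y).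
    split; [intros H'|lia].
    assert (E : x * x + y * y = u) by lia.
    assert ((x mod 2 = 0 /\ y mod 2 = 1) \/ (y mod 2 = 0 /\ x mod 2 = 1)).
    { generalize dependent (x * x); generalize dependent (y * y); intros; lia. }
    lia.
  + intros [x y] (H1 & H2 & _) (H3 & H4 & _); cbn [fst snd] in *; lia.
- apply wsum_empty; intros [x y] (H1 & H2 & H3); cbn [fst snd] in *.
  pose proof (square_mod2 x); pose proof (square_mod2 y).
  generalize dependent (x * x); generalize dependent (y * y); intros; lia.
Qed.

(** The first conjunct only fixes parities. Fixing [k = 2K] leaves three squares with sum
    [2 (N - 2 K^2)]; fixing [e^2 + o^2] leaves two independent two-square problems. *)
Definition four_squares (N : Z) (x : Z * Z * Z * Z) : Prop :=
  let '(e, o, k, o') := x in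
  even_odd_squares (e * e + o * o) (e, o) /\ even_odd_squares (2 * N - (e * e + o * o)) (k, o').

Lemma finite_four_squares N : finite (four_squares N).
Proof.
apply (finite_Z4 _ (2 * Z.abs N)); intros e o k o' (H1 & (_ & _ & H2)); cbn [fst snd] in *.
pose proof (abs_le_square e); pose proof (abs_le_square o).
pose proof (abs_le_square k); pose proof (abs_le_square o'); lia.
Qed.

Lemma sum_three_squares N :
  wsum (interval (2 * Z.abs N)) (fun K => setcard (three_squares (N - 2 * K * K)))
  = setcard (four_squares N).
Proof.
symmetry; unfold setcard at 1.
rewrite (wsum_fibre (four_squares N) (interval (2 * Z.abs N)) (fun x => let '(e, o, k, o') := x in k / 2)).
2: apply finite_four_squares.
2: apply finite_interval.
2: { intros [[[e o] k] o'] (H1 & (_ & _ & H2)); unfold interval; cbn [fst snd] in *.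
     pose proof (abs_le_square e); pose proof (abs_le_square o).
     pose proof (abs_le_square k); pose proof (abs_le_square o'); lia. }
apply wsum_ext; [apply finite_interval|tauto|].
intros K _.
apply (wsum_bij _ _ (fun x => let '(e, o, k, o') := x in (e, o, o'))
  (fun x => let '(e, o, o') := x in (e, o, 2 * K, o'))).
- apply (finite_sub _ _ (finite_four_squares N)); tauto.
- intros [[[e o] k] o'] [((E1 & E2 & _) & (E3 & E4 & E5)) HK]; cbn [fst snd] in *.
  assert (Hk : k = 2 * K) by lia; subst k; clear HK.
  split; [|split; reflexivity].
  repeat split; auto; lia.
- intros [[e o] o'] (E1 & E2 & E3 & E4); split; [|reflexivity].
  unfold four_squares, even_odd_squares; cbn [fst snd]; repeat split; auto; lia.
Qed.

(** A convolution over [u = e^2 + o^2]: each factor is twice a divisor sum, which gives four times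
    the sum of [chi a * chi s] over [a c = u], [s t = 2N - u]. *)
Lemma card_four_squares N : 0 < N -> N mod 2 = 1 -> setcard (four_squares N) = 4 * setcard (hermite N).
Proof.
intros HN Ho; rewrite -sum_chi_odd_quads; auto.
set (I := fun u => 0 <= u <= 2 * N).
assert (HI : finite I) by (apply (finite_Z _ (2 * N)); unfold I; lia).
unfold setcard; rewrite (wsum_fibre (four_squares N) I (fun x => let '(e, o, k, o') := x in e * e + o * o)); auto.
2: apply finite_four_squares.
2: { intros [[[e o] k] o'] (_ & (_ & _ & H)); cbn [fst snd] in *; unfold I.
     pose proof (Z.square_nonneg e); pose proof (Z.square_nonneg o).
     pose proof (Z.square_nonneg k); pose proof (Z.square_nonneg o'); lia. }
rewrite (wsum_fibre (odd_quads (2 * N)) I (fun x => let '(a, c, s, t) := x in a * c)); auto.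
2: apply finite_odd_quads0.
2: { intros [[[a c] s] t] ((H1 & H2 & H3 & H4) & _ & H); unfold I.
     assert (0 < a * c) by (apply Z.mul_pos_pos; lia).
     assert (0 < s * t) by (apply Z.mul_pos_pos; lia). lia. }
rewrite -wsum_scale; apply wsum_ext; [exact HI|tauto|].
intros u Hu; unfold I in Hu.
transitivity (setcard (even_odd_squares u) * setcard (even_odd_squares (2 * N - u))).
{ unfold setcard; rewrite -wsum_prod; try apply finite_even_odd_squares.
  apply (wsum_bij _ _ (fun x => let '(e, o, k, o') := x in ((e, o), (k, o')))
    (fun x => let '((e, o), (k, o')) := x in (e, o, k, o'))).
  - apply (finite_sub _ _ (finite_four_squares N)); tauto.
  - intros [[[e o] k] o'] [(H1 & H2) Hx]; rewrite Hx in H1 H2; cbn [fst snd]; auto.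
  - intros [[e o] [k o']] [H1 H2]; cbn [fst snd] in *.
    pose proof H1 as (_ & _ & E); cbn [fst snd] in E.
    unfold four_squares; rewrite E; auto. }
rewrite !card_even_odd_squares; [|lia|lia].
destruct (Z.eqb_spec (u mod 2) 1) as [E|E]; destruct (Z.eqb_spec ((2 * N - u) mod 2) 1) as [E'|E']; try lia.
- transitivity (4 * (wsum (divs 1 u) chi1 * wsum (divs 1 (2 * N - u)) chi1)); [ring|f_equal].
  rewrite -wsum_prod; try (apply finite_divs; lia).
  symmetry; apply (wsum_bij _ _ (fun x => let '(e, o, k, o') := x in ((e, o), (k, o')))
    (fun x => let '((e, o), (k, o')) := x in (e, o, k, o'))).
  + apply (finite_sub _ _ (finite_odd_quads0 (2 * N))); tauto.
  + intros [[[a c] s] t] [((H1 & H2 & H3 & H4) & _ & H) Hx]; unfold divs; cbn [fst snd].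
    repeat split; auto; lia.
  + intros [[a c] [s t]] [(H1 & H2 & H) (H1' & H2' & H')]; cbn [fst snd] in *.
    destruct (odd_mul a c) as [Q1 Q2]; [rewrite -E; f_equal; lia|].
    destruct (odd_mul s t) as [Q3 Q4]; [rewrite -E'; f_equal; lia|].
    unfold odd_quads; repeat split; auto; lia.
- rewrite wsum_empty; [reflexivity|].
  intros [[[a c] s] t] [(_ & (H1 & H2 & _) & _) Hx].
  apply E; rewrite -Hx Zmult_mod H1 H2; reflexivity.
Qed.

Lemma three_squares_nonpos m : m <= 0 -> setcard (three_squares m) = 4 * setcard (reduced_forms m).
Proof.
intros Hm; unfold setcard; rewrite !wsum_empty; [reflexivity| |].
- intros [[a c] T] (Ha & Hc & H & H1 & H2).
  assert (Hac : 2 * T * (2 * T) < a * c).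
  { rewrite -(Z.abs_square (2 * T)); apply Z.mul_lt_mono_nonneg; lia. }
  pose proof (Z.square_nonneg T); lia.
- intros [[e o] o'] (_ & Ho & _ & H).
  pose proof (Z.square_nonneg e); pose proof (Z.square_nonneg o').
  assert (0 < o * o) by (assert (o <> 0) by lia; clear -H2; nia). lia.
Qed.

(* Both sides satisfy the same recursion [sum over K of f (N - 2 K^2)]. *)
Lemma card_three_squares (n : nat) : forall m, m <= Z.of_nat n -> m mod 2 = 1 ->
  setcard (three_squares m) = 4 * setcard (reduced_forms m).
Proof.
induction n as [|n IH]; intros m Hm Ho; [apply three_squares_nonpos; lia|].
destruct (Z_le_gt_dec m 0) as [H0|H0]; [now apply three_squares_nonpos|].
pose proof (sum_three_squares m) as H1; rewrite card_four_squares in H1; [|lia|exact Ho].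
pose proof (sum_reduced_forms m) as H2; rewrite card_reduced_bases in H2; [|lia|exact Ho].
set (I := interval (2 * Z.abs m)) in *.
(* The term [K = 0] is isolated; all others belong to odd numbers [m - 2 K^2] smaller than [m]. *)
assert (Hs : forall f, wsum I f = f 0 + wsum (fun K => I K /\ K <> 0) f).
{ intros f; rewrite (wsum_split I (fun K => I K /\ K = 0) (fun K => I K /\ K <> 0)).
  - f_equal; apply wsum_single; unfold I, interval; lia.
  - apply finite_interval.
  - intros K; destruct (Z.eq_dec K 0); tauto.
  - tauto. }
rewrite Hs in H1; rewrite Hs in H2.
replace (m - 2 * 0 * 0) with m in H1, H2 by ring.
assert (H3 : wsum (fun K => I K /\ K <> 0) (fun K => setcard (three_squares (m - 2 * K * K)))
  = 4 * wsum (fun K => I K /\ K <> 0) (fun K => setcard (reduced_forms (m - 2 * K * K)))).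
{ rewrite -wsum_scale; apply wsum_ext; [|tauto|].
  - apply (finite_sub _ I); [apply finite_interval|tauto].
  - intros K [_ HK]; apply IH.
    + assert (1 <= K * K) by (clear -HK; nia); lia.
    + generalize dependent (K * K); intros; lia. }
lia.
Qed.

Lemma double_odd_three_squares m : 0 < m -> m mod 2 = 1 ->
  exists e o o', e mod 2 = 0 /\ o mod 2 = 1 /\ o' mod 2 = 1 /\ e * e + o * o + o' * o' = 2 * m.
Proof.
intros Hm Ho.
destruct (setcard_inhabited (three_squares m)) as [[[e o] o'] H]; [|now exists e, o, o'].
rewrite (card_three_squares (Z.to_nat m)); [|lia|exact Ho].
assert (0 < setcard (reduced_forms m)); [|lia].
apply (setcard_pos _ (1, m, 0)); [|unfold reduced_forms; lia].
apply (finite_Z3 _ (2 * m)); intros a c T (Ha & Hc & H & H1 & H2).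
assert (Hac : 2 * T * (2 * T) < a * c).
{ rewrite -(Z.abs_square (2 * T)); apply Z.mul_lt_mono_nonneg; lia. }
assert (a <= a * c /\ c <= a * c) by (clear -Ha Hc; nia); lia.
Qed.

(** * From three squares to pentagonal numbers *)

Lemma square_mod3 x : (x mod 3 = 0 /\ (x * x) mod 3 = 0) \/ (x mod 3 <> 0 /\ (x * x) mod 3 = 1).
Proof.
assert (H : (x * x) mod 3 = ((x mod 3) * (x mod 3)) mod 3) by apply Zmult_mod.
assert (x mod 3 = 0 \/ x mod 3 = 1 \/ x mod 3 = 2) as [E|[E|E]] by lia; rewrite E in H; rewrite H E;
  [left|right|right]; split; try reflexivity; lia.
Qed.

Lemma sign_mod3 a c : (a mod 3 = 0 <-> c mod 3 = 0) ->
  exists a', (a' = a \/ a' = - a) /\ (a' + c) mod 3 = 0.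
Proof.
intros H; destruct (Z.eq_dec ((a + c) mod 3) 0); [exists a|exists (- a)]; split; auto; lia.
Qed.

(** If [a^2 + b^2 + c^2 = 6N], then [(a + b + 2c)^2 + 2 (a + b - c)^2 + 3 (a - b)^2 = 36N]. The
    three bases are even by parity, and they are multiples of 3 once signs are chosen so that [a]
    and [b] are congruent to [-c]. *)
Lemma ternary_123_odd N : 0 < N -> N mod 2 = 1 -> exists x y z, x * x + 2 * y * y + 3 * z * z = N.
Proof.
intros HN Ho.
destruct (double_odd_three_squares (3 * N)) as (c & a & b & Hc & Ha & Hb & H); [lia|lia|].
assert (Hac : (a mod 3 = 0 <-> c mod 3 = 0) /\ (b mod 3 = 0 <-> c mod 3 = 0)).
{ pose proof (square_mod3 a); pose proof (square_mod3 b); pose proof (square_mod3 c).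
  generalize dependent (a * a); generalize dependent (b * b); generalize dependent (c * c); intros; lia. }
destruct (sign_mod3 a c) as (a' & Ea & Ha'); [tauto|].
destruct (sign_mod3 b c) as (b' & Eb & Hb'); [tauto|].
assert (H' : c * c + a' * a' + b' * b' = 2 * (3 * N)).
{ rewrite -H; destruct Ea as [-> | ->], Eb as [-> | ->]; ring. }
assert (Ex : a' + b' + 2 * c = 6 * ((a' + b' + 2 * c) / 6)) by lia.
assert (Ey : a' + b' - c = 6 * ((a' + b' - c) / 6)) by lia.
assert (Ez : a' - b' = 6 * ((a' - b') / 6)) by lia.
exists ((a' + b' + 2 * c) / 6), ((a' + b' - c) / 6), ((a' - b') / 6).
assert (E : (a' + b' + 2 * c) * (a' + b' + 2 * c) + 2 * (a' + b' - c) * (a' + b' - c)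
  + 3 * (a' - b') * (a' - b') = 36 * N).
{ transitivity (6 * (c * c + a' * a' + b' * b')); [ring|rewrite H'; ring]. }
rewrite Ex Ey Ez in E; clear -E.
revert E; generalize ((a' + b' + 2 * c) / 6) ((a' + b' - c) / 6) ((a' - b') / 6); intros x y z E.
lia.
Qed.

Lemma ternary_123 N : 0 < N -> N mod 2 = 1 \/ N mod 8 = 4 ->
  exists x y z, x * x + 2 * y * y + 3 * z * z = N.
Proof.
intros HN [Ho|Ho]; [now apply ternary_123_odd|].
destruct (ternary_123_odd (N / 4)) as (x & y & z & H); [lia|lia|].
exists (2 * x), (2 * y), (2 * z).
transitivity (4 * (x * x + 2 * y * y + 3 * z * z)); [ring|rewrite H; lia].
Qed.

(* [2 y^2 + 3 z^2] is multiplied by [25 = N(1 + 2 sqrt(-6))] in two ways. *)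
Lemma binary_23_prime_to_5 (n : nat) : forall u v, Z.abs u + Z.abs v <= Z.of_nat n ->
  u <> 0 \/ v <> 0 ->
  exists y z, 2 * y * y + 3 * z * z = 2 * u * u + 3 * v * v /\ ~ (y mod 5 = 0 /\ z mod 5 = 0).
Proof.
induction n as [|n IH]; intros u v Hn Huv; [lia|].
destruct (classic (u mod 5 = 0 /\ v mod 5 = 0)) as [[Hu Hv]|H]; [|exists u, v; auto].
destruct (IH (u / 5) (v / 5)) as (y & z & H & Hyz); [lia|lia|].
assert (E : 2 * u * u + 3 * v * v = 25 * (2 * y * y + 3 * z * z)).
{ rewrite H; assert (Eu : u = 5 * (u / 5)) by lia; assert (Ev : v = 5 * (v / 5)) by lia.
  rewrite {1 2}Eu {1 2}Ev; ring. }
rewrite E.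
(* Modulo 5 the candidates are [(y + z, y + z)] and [(y - z, z - y)], which cannot both vanish. *)
destruct (Z.eq_dec ((y - z) mod 5) 0).
- exists (y + 6 * z), (z - 4 * y); split; [ring|lia].
- exists (y - 6 * z), (z + 4 * y); split; [ring|lia].
Qed.

Definition sign_test (t u v b : Z) : bool :=
  List.existsb (fun s : Z * Z * Z => let '(s1, s2, s3) := s in
    ((s1 * t + 2 * (s2 * u) + s3 * v) mod 5 =? 0) && ((s2 * u - s1 * t - b) mod 5 =? 0))
  [:: (1, 1, 1); (1, 1, -1); (1, -1, 1); (1, -1, -1);
      (-1, 1, 1); (-1, 1, -1); (-1, -1, 1); (-1, -1, -1)].

Lemma sign_test_all :
  List.forallb (fun t => List.forallb (fun u => List.forallb (fun v => List.forallb (fun b =>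
    implb (((t * t + 2 * u * u + 3 * v * v + b * b) mod 5 =? 0) && negb (b =? 0)
           && negb ((u =? 0) && (v =? 0))) (sign_test t u v b))
  [:: 0; 1; 2; 3; 4]) [:: 0; 1; 2; 3; 4]) [:: 0; 1; 2; 3; 4]) [:: 0; 1; 2; 3; 4] = true.
Proof. reflexivity. Qed.

Lemma in_residues5 x : In (x mod 5) [:: 0; 1; 2; 3; 4].
Proof.
assert (x mod 5 = 0 \/ x mod 5 = 1 \/ x mod 5 = 2 \/ x mod 5 = 3 \/ x mod 5 = 4) by lia.
cbn [In]; intuition.
Qed.

(** These congruences make the divisions by 5 in [represented_of_ternary] exact. If 5 divided [u]
    and [v], then [t] would be [2b] or [-2b] modulo 5 and no sign would give [-t = b]. *)
Lemma signs_mod5 t u v b : (t * t + 2 * u * u + 3 * v * v + b * b) mod 5 = 0 -> b mod 5 <> 0 ->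
  ~ (u mod 5 = 0 /\ v mod 5 = 0) ->
  exists t' u' v', (t' = t \/ t' = - t) /\ (u' = u \/ u' = - u) /\ (v' = v \/ v' = - v) /\
    (t' + 2 * u' + v') mod 5 = 0 /\ (u' - t' - b) mod 5 = 0.
Proof.
intros H Hb Huv; pose proof sign_test_all as A.
rewrite List.forallb_forall in A; specialize (A _ (in_residues5 t)).
rewrite List.forallb_forall in A; specialize (A _ (in_residues5 u)).
rewrite List.forallb_forall in A; specialize (A _ (in_residues5 v)).
rewrite List.forallb_forall in A; specialize (A _ (in_residues5 b)).
assert (H' : (t mod 5 * (t mod 5) + 2 * (u mod 5) * (u mod 5) + 3 * (v mod 5) * (v mod 5)
   + b mod 5 * (b mod 5)) mod 5 = 0).
{ rewrite -H.
  rewrite (Z.div_mod t 5 ltac:(lia)) (Z.div_mod u 5 ltac:(lia)) (Z.div_mod v 5 ltac:(lia))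
    (Z.div_mod b 5 ltac:(lia)).
  rewrite !(Z.mul_comm 5) !(Z.add_comm (_ * 5)) !Z_mod_plus_full !Zmod_mod.
  set (t0 := t mod 5); set (u0 := u mod 5); set (v0 := v mod 5); set (b0 := b mod 5).
  set (t1 := t / 5); set (u1 := u / 5); set (v1 := v / 5); set (b1 := b / 5).
  match goal with |- ?x mod 5 = ?y mod 5 => replace y with (x +
    (2 * t0 * t1 + 5 * t1 * t1 + 2 * (2 * u0 * u1 + 5 * u1 * u1) + 3 * (2 * v0 * v1 + 5 * v1 * v1)
     + 2 * b0 * b1 + 5 * b1 * b1) * 5) by ring end.
  symmetry; apply Z_mod_plus_full. }
rewrite (proj2 (Z.eqb_eq _ _) H') in A.
rewrite (proj2 (Z.eqb_neq _ _) Hb) in A.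
destruct ((u mod 5 =? 0) && (v mod 5 =? 0)) eqn:E.
{ exfalso; apply andb_prop in E; rewrite !Z.eqb_eq in E; tauto. }
change (sign_test (t mod 5) (u mod 5) (v mod 5) (b mod 5) = true) in A.
unfold sign_test in A; rewrite List.existsb_exists in A.
destruct A as ([[s1 s2] s3] & Hin & Hs); apply andb_prop in Hs; rewrite !Z.eqb_eq in Hs.
destruct Hs as [Hs1 Hs2].
exists (s1 * t), (s2 * u), (s3 * v); clear H H' Hb Huv E.
cbn [In] in Hin.
repeat destruct Hin as [Hin|Hin]; try (destruct Hin; fail); injection Hin as <- <- <-; lia.
Qed.

(** * From ternary representations to pentagonal sums *)

Definition penta (k : Z) : Z := k * (3 * k - 1) / 2.

Lemma two_penta k : 2 * penta k = k * (3 * k - 1).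
Proof.
unfold penta.
assert (H : (k * (3 * k - 1)) mod 2 = 0).
{ assert (k = 2 * (k / 2) \/ k = 2 * (k / 2) + 1) as [E|E] by lia; rewrite E; generalize (k / 2); intros j.
  - replace (2 * j * (3 * (2 * j) - 1)) with (j * (3 * (2 * j) - 1) * 2) by ring; apply Z_mod_mult.
  - replace ((2 * j + 1) * (3 * (2 * j + 1) - 1)) with ((2 * j + 1) * (3 * j + 1) * 2) by ring; apply Z_mod_mult. }
lia.
Qed.

Definition represented (n : Z) : Prop := exists w x y z,
  0 <= w /\ 0 <= x /\ 0 <= y /\ 0 <= z /\ n = penta w + 2 * penta x + 3 * penta y + 4 * penta z.

Lemma square_bound_abs x b : 0 <= b -> x * x <= b * b -> - b <= x <= b.
Proof.
intros Hb H; split.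
- assert (- x <= b); [|lia]; apply Z.square_le_simpl_nonneg; lia.
- apply Z.square_le_simpl_nonneg; lia.
Qed.

(* With [w + 2x + 3y + 4z = 2 be] and [w^2 + 2x^2 + 3y^2 + 4z^2 = 2 al] one has
   [t^2 + 2u^2 + 3v^2 = 5 al - be^2] for [u = w - z], [v = x - y] and [2t = w - 2x - 3y + 4z]. *)
Lemma represented_of_ternary n al be : n = 3 * al - be -> 0 < be -> be mod 5 <> 0 ->
  9 * al <= 2 * be * be -> 0 < 5 * al - be * be ->
  (5 * al - be * be) mod 4 = 3 \/ (5 * al - be * be) mod 16 = 12 -> represented n.
Proof.
intros Hn Hb Hb5 Hlow Hpos Hmod.
set (N := 5 * al - be * be) in *.
destruct (ternary_123 N) as (t0 & u0 & v0 & H0); [exact Hpos|lia|].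
(* Being 3 modulo 4 or 12 modulo 16, [N] is not a square. *)
assert (Huv0 : u0 <> 0 \/ v0 <> 0).
{ destruct (Z.eq_dec u0 0) as [Eu|]; [|now left]; right; intros Ev.
  assert (E : t0 * t0 = N) by (rewrite -H0 Eu Ev; ring).
  rewrite -E in Hmod.
  destruct (square_mod8 t0) as [[Hp Hq]|[Hp Hq]].
  - assert (Et : t0 = 2 * (t0 / 2)) by lia.
    assert (E4 : t0 * t0 = 4 * (t0 / 2 * (t0 / 2))) by (rewrite {1 2}Et; ring).
    destruct (square_mod8 (t0 / 2)) as [[Hr Hs]|[Hr Hs]];
      generalize dependent (t0 / 2 * (t0 / 2)); generalize dependent (t0 * t0); intros; lia.
  - generalize dependent (t0 * t0); intros; lia. }
destruct (binary_23_prime_to_5 (Z.to_nat (Z.abs u0 + Z.abs v0)) u0 v0) as (u1 & v1 & H1 & Huv1);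
  [lia|exact Huv0|].
assert (HN : t0 * t0 + 2 * u1 * u1 + 3 * v1 * v1 = N) by lia.
destruct (signs_mod5 t0 u1 v1 be) as (t & u & v & Et & Eu & Ev & Hm1 & Hm2); auto.
{ rewrite HN /N; replace (5 * al - be * be + be * be) with (al * 5) by ring; apply Z_mod_mult. }
assert (HNs : t * t + 2 * u * u + 3 * v * v = N).
{ rewrite -HN; destruct Et as [-> | ->], Eu as [-> | ->], Ev as [-> | ->]; ring. }
clear t0 u0 v0 H0 Huv0 u1 v1 H1 Huv1 HN Et Eu Ev.
(* The constant 9 comes from [5w = be + t + 4u] and [(t + 4u)^2 <= 9 (t^2 + 2u^2)], the most
   demanding of the four bounds. *)
assert (H9 : 9 * (t * t + 2 * u * u + 3 * v * v) <= be * be) by (rewrite HNs /N; lia).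
set (z := (be + t - u) / 5); set (y := (be - t - 2 * v) / 5).
assert (Ez : 5 * z = be + t - u) by (unfold z; lia).
assert (Ey : 5 * y = be - t - 2 * v) by (unfold y; lia).
pose proof (Z.square_nonneg t) as St; pose proof (Z.square_nonneg u) as Su.
pose proof (Z.square_nonneg v) as Sv.
assert (Bz : - be <= t - u <= be).
{ apply square_bound_abs; [lia|]; pose proof (Z.square_nonneg (t + u)); lia. }
assert (Bw : - be <= t + 4 * u <= be).
{ apply square_bound_abs; [lia|]; pose proof (Z.square_nonneg (2 * t - u)); lia. }
assert (By : - be <= t + 2 * v <= be).
{ apply square_bound_abs; [lia|]; pose proof (Z.square_nonneg (t - v)); lia. }
assert (Bx : - be <= t - 3 * v <= be).
{ apply square_bound_abs; [lia|]; pose proof (Z.square_nonneg (t + v)); lia. }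
exists (z + u), (y + v), y, z; repeat split; try lia.
apply (Z.mul_reg_l _ _ 2); [lia|].
transitivity (2 * penta (z + u) + 2 * (2 * penta (y + v)) + 3 * (2 * penta y) + 4 * (2 * penta z)); [|ring].
rewrite !two_penta.
apply (Z.mul_reg_l _ _ 5); [lia|].
transitivity (3 * ((5 * z + u) * (5 * z + u) + 4 * (u * u) + (5 * y + 2 * v) * (5 * y + 2 * v) + 6 * (v * v))
  - (5 * (5 * z) + 5 * u + 5 * (5 * y) + 10 * v)); [|ring].
rewrite Ez Ey.
transitivity (6 * (be * be + (t * t + 2 * u * u + 3 * v * v)) - 10 * be); [|ring].
rewrite HNs /N Hn; ring.
Qed.

(** With [3 al = n + be] the tested number is [3 (5 al - be^2)], so the values 1 modulo 4 and 4
    modulo 16 mean 3 modulo 4 and 12 modulo 16 for [5 al - be^2]. *)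
Definition residue_test (n0 r : Z) : bool :=
  ((n0 + r) mod 3 =? 0) &&
  (if n0 mod 2 =? 1 then (5 * (n0 + r) - 3 * r * r) mod 4 =? 1
   else (5 * (n0 + r) - 3 * r * r) mod 16 =? 4).

Lemma residue_test_all :
  List.forallb (fun i => List.existsb (fun j => residue_test (Z.of_nat i) (Z.of_nat j)) (List.seq 0 48)) (List.seq 0 48) = true.
Proof. vm_compute; reflexivity. Qed.

Lemma good_residue n : exists r, forall be, be mod 48 = r mod 48 -> (n + be) mod 3 = 0 /\
  ((5 * (n + be) - 3 * be * be) mod 4 = 1 \/ (5 * (n + be) - 3 * be * be) mod 16 = 4).
Proof.
pose proof residue_test_all as A; rewrite List.forallb_forall in A.
specialize (A (Z.to_nat (n mod 48))).
rewrite List.existsb_exists in A; destruct A as (j & _ & Hj).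
{ apply in_seq; lia. }
exists (Z.of_nat j); intros be Hbe.
rewrite Z2Nat.id in Hj; [|lia].
unfold residue_test in Hj; apply andb_prop in Hj; destruct Hj as [Hj1 Hj2].
rewrite Z.eqb_eq in Hj1.
set (n0 := n mod 48) in *; set (r := Z.of_nat j) in *.
assert (En : exists i, n = n0 + 48 * i) by (exists (n / 48); unfold n0; lia).
assert (Eb : exists i, be = r + 48 * i) by (exists (be / 48 - r / 48); lia).
clearbody n0 r; destruct En as [i ->], Eb as [k ->].
split; [lia|].
assert (E : 5 * (n0 + 48 * i + (r + 48 * k)) - 3 * (r + 48 * k) * (r + 48 * k)
  = (5 * (n0 + r) - 3 * r * r) + (5 * i + 5 * k - 6 * r * k - 144 * k * k) * 48) by ring.
rewrite E; revert Hj2; generalize (5 * (n0 + r) - 3 * r * r); intros m Hm.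
generalize (5 * i + 5 * k - 6 * r * k - 144 * k * k); intros q.
destruct (n0 mod 2 =? 1); rewrite Z.eqb_eq in Hm; lia.
Qed.

Lemma represented_large n : 3000000 <= n -> represented n.
Proof.
intros Hn.
destruct (good_residue n) as [r Hr].
set (s := Z.sqrt n).
assert (Hs : s * s <= n < (s + 1) * (s + 1)) by (apply Z.sqrt_spec; lia).
assert (Hs0 : 1732 <= s).
{ apply (Z.sqrt_le_mono (1732 * 1732)); lia. }
clearbody s.
(* The factor 1.23 lies slightly above [sqrt (3/2)], to absorb rounding and the term [be] in
   [3 al = n + be]. *)
set (L := 123 * s / 100 + 1).
(* The first 48 values contain the wanted class; if that [be] is a multiple of 5, [be + 48] is
   not. *)
assert (Hbe : exists be, L <= be < L + 96 /\ be mod 48 = r mod 48 /\ be mod 5 <> 0).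
{ set (b := L + (r - L) mod 48).
  assert (b mod 48 = r mod 48) by (unfold b; lia).
  destruct (Z.eq_dec (b mod 5) 0); [exists (b + 48)|exists b]; unfold b in *; lia. }
destruct Hbe as (be & HL & Hm & H5).
destruct (Hr be Hm) as [H3 Hmod].
assert (Ha : exists al, n + be = 3 * al) by (exists ((n + be) / 3); lia).
destruct Ha as [al Hal].
assert (B1 : 123 * s <= 100 * be <= 123 * s + 9700) by (unfold L in HL; lia).
assert (S1 : 123 * s * (123 * s) <= 100 * be * (100 * be)) by (apply Z.mul_le_mono_nonneg; lia).
assert (S2 : 100 * be * (100 * be) <= (123 * s + 9700) * (123 * s + 9700)) by (apply Z.mul_le_mono_nonneg; lia).
assert (S3 : 1732 * s <= s * s) by (apply Z.mul_le_mono_nonneg_r; lia).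
apply (represented_of_ternary n al be); auto; try lia.
Qed.

(** * Small numbers *)

Definition zseq (n : nat) : list Z := List.map Z.of_nat (List.seq 0 n).

(* The numbers [penta w + 2 * penta x < 26000], shifted by one. *)
Definition two_term_set : PositiveSet.t :=
  fold_right (fun x s => let q := 2 * penta x in
    fold_right (fun w s => let m := penta w + q in
      if m <? 26000 then PositiveSet.add (Z.to_pos (m + 1)) s else s) s (zseq 133))
  PositiveSet.empty (zseq 95).

(** [Z.to_pos] sends every nonpositive integer to 1, the code of 0; hence the guard against negative
    [m]. *)
Definition two_term_mem (s : PositiveSet.t) (m : Z) : bool :=
  match m with Zneg _ => false | _ => PositiveSet.mem (Z.to_pos (m + 1)) s end.

(* Not written with [existsb]: the virtual machine evaluates both sides of [||]. *)
Fixpoint three_term_test (s : PositiveSet.t) (qs : list Z) (r : Z) : bool :=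
  match qs with
  | [::] => false
  | q :: qs' => if two_term_mem s (r - q) then true else three_term_test s qs' r
  end.

Definition three_penta : list Z := List.map (fun y => 3 * penta y) (zseq 100).

(** By [cover_test_true] this contains every number below 8600 that is not
    [penta w + 2 penta x + 3 penta y] with nonnegative [w, x, y]. *)
Definition exceptions : list Z := [:: 9; 19; 21; 23; 31; 33; 34; 42; 55; 57; 63; 84; 93; 96; 99; 100; 104; 113; 123; 126; 133; 135; 159; 174; 195; 216; 231; 240; 243; 265; 273; 303; 309; 318; 336; 384; 405; 408; 411; 441; 489; 518; 546; 555; 558; 569; 618; 657; 671; 693; 699; 723; 798; 801; 831; 834; 909; 924; 939; 996; 1113; 1155; 1254; 1263; 1365; 1386; 1449; 1689; 1725; 1750; 1848; 1899; 2085; 2088; 2228; 2295; 2319; 2376; 2970; 2973; 2982; 3174; 3954; 4398; 4587; 5049; 5259; 6348; 6729].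

Definition cover_test (s : PositiveSet.t) (qs : list Z) : bool :=
  List.forallb (fun r => if three_term_test s qs r then true else List.existsb (Z.eqb r) exceptions) (zseq 8600).

(** Lowering [z] by 1 or 2 raises the remainder [n - 4 penta z] by [12z - 8] or [24z - 28].
    Remainders from [12z + 4 = 4 penta (z + 1) - 4 penta z] on cannot occur for the largest [z]. *)
Definition exceptions_test (s : PositiveSet.t) (qs : list Z) : bool :=
  List.forallb (fun z => List.forallb (fun e =>
    if 12 * z + 4 <=? e then true
    else if (if 1 <=? z then three_term_test s qs (e + 12 * z - 8) else false) then true
    else if 2 <=? z then three_term_test s qs (e + 24 * z - 28) else false) exceptions) (zseq 709).

Lemma cover_test_true : cover_test two_term_set three_penta = true.
Proof. vm_cast_no_check (Logic.eq_refl true). Qed.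

Lemma exceptions_test_true : exceptions_test two_term_set three_penta = true.
Proof. vm_cast_no_check (Logic.eq_refl true). Qed.

(** * Soundness of the computations *)

Lemma in_zseq n x : In x (zseq n) <-> 0 <= x < Z.of_nat n.
Proof.
unfold zseq; rewrite in_map_iff; split.
- intros (k & <- & H); apply in_seq in H; lia.
- intros H; exists (Z.to_nat x); rewrite in_seq; lia.
Qed.

Lemma two_term_memP s m : two_term_mem s m = true ->
  0 <= m /\ PositiveSet.mem (Z.to_pos (m + 1)) s = true.
Proof.
unfold two_term_mem; destruct m; intros H; [split; [lia|exact H]|split; [lia|exact H]|discriminate].
Qed.

Lemma two_term_set_sound m : 0 <= m -> PositiveSet.mem (Z.to_pos (m + 1)) two_term_set = true ->
  exists w x, 0 <= w /\ 0 <= x /\ m = penta w + 2 * penta x.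
Proof.
intros Hm H.
assert (Hpos : forall k, 0 <= k -> 0 <= penta k).
{ intros k Hk; pose proof (two_penta k); destruct (Z.eq_dec k 0) as [->|]; [reflexivity|].
  assert (0 <= k * (3 * k - 1)) by (apply Z.mul_nonneg_nonneg; lia); lia. }
set (G := fun s => forall i, PositiveSet.In i s ->
  exists w x, 0 <= w /\ 0 <= x /\ i = Z.to_pos (penta w + 2 * penta x + 1)).
assert (HG : G two_term_set).
{ assert (Hin : forall x l s, 0 <= x -> (forall w, In w l -> 0 <= w) -> G s -> G
    (fold_right (fun w s => let m := penta w + 2 * penta x in
      if m <? 26000 then PositiveSet.add (Z.to_pos (m + 1)) s else s) s l)).
  { intros x l s Hx; induction l as [|w l IH]; intros Hl Hs; [exact Hs|].
    cbn [fold_right]; cbv zeta.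
    destruct (penta w + 2 * penta x <? 26000); [|apply IH; auto; intros; apply Hl; now right].
    intros i Hi; apply PositiveSet.add_spec in Hi; destruct Hi as [->|Hi].
    - exists w, x; repeat split; auto; apply Hl; now left.
    - apply IH; auto; intros; apply Hl; now right. }
  assert (Hout : forall l, (forall x, In x l -> 0 <= x) -> G
    (fold_right (fun x s => let q := 2 * penta x in
      fold_right (fun w s => let m := penta w + q in
        if m <? 26000 then PositiveSet.add (Z.to_pos (m + 1)) s else s) s (zseq 133))
     PositiveSet.empty l)).
  { induction l as [|x l IH]; intros Hl.
    - intros i Hi; discriminate.
    - cbn [fold_right]; cbv zeta; apply Hin.
      + apply Hl; now left.
      + intros w Hw; apply in_zseq in Hw; lia.
      + apply IH; intros; apply Hl; now right. }
  apply Hout; intros x Hx; apply in_zseq in Hx; lia. }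
destruct (HG (Z.to_pos (m + 1))) as (w & x & Hw & Hx & E).
{ apply PositiveSet.mem_spec, H. }
exists w, x; repeat split; auto.
pose proof (Hpos w Hw); pose proof (Hpos x Hx).
apply (f_equal Zpos) in E; rewrite !Z2Pos.id in E; lia.
Qed.

Lemma three_term_test_sound r : three_term_test two_term_set three_penta r = true ->
  exists w x y, 0 <= w /\ 0 <= x /\ 0 <= y /\ r = penta w + 2 * penta x + 3 * penta y.
Proof.
assert (Hqs : forall q, In q three_penta -> exists y, 0 <= y /\ q = 3 * penta y).
{ unfold three_penta; intros q Hq; apply in_map_iff in Hq; destruct Hq as (y & <- & Hy).
  apply in_zseq in Hy; exists y; lia. }
revert Hqs; generalize three_penta; intros qs; induction qs as [|q qs IH]; intros Hqs H; [discriminate|].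
cbn [three_term_test] in H.
destruct (two_term_mem two_term_set (r - q)) eqn:E; [|apply IH; auto; intros; apply Hqs; now right].
destruct (Hqs q) as (y & Hy & ->); [now left|].
destruct (two_term_set_sound (r - 3 * penta y)) as (w & x & Hw & Hx & Ewx).
- now apply (two_term_memP two_term_set).
- now apply (two_term_memP two_term_set).
- clear -Hy Hw Hx Ewx; exists w, x, y; repeat split; lia.
Qed.

Lemma cover_test_sound s qs r : cover_test s qs = true -> 0 <= r < 8600 ->
  three_term_test s qs r = true \/ In r exceptions.
Proof.
unfold cover_test; rewrite List.forallb_forall; intros H Hr; specialize (H r).
rewrite in_zseq in H; specialize (H Hr).
destruct (three_term_test s qs r); [now left|right].
apply List.existsb_exists in H; destruct H as (e & He & E); apply Z.eqb_eq in E; congruence.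
Qed.

Lemma exceptions_test_sound s qs z e : exceptions_test s qs = true -> 0 <= z < 709 ->
  In e exceptions -> e < 12 * z + 4 ->
  1 <= z /\ three_term_test s qs (e + 12 * z - 8) = true \/
  2 <= z /\ three_term_test s qs (e + 24 * z - 28) = true.
Proof.
unfold exceptions_test; rewrite List.forallb_forall; intros H Hz He Hlt; specialize (H z).
rewrite in_zseq in H; specialize (H Hz).
rewrite List.forallb_forall in H; specialize (H e He).
destruct (Z.leb_spec (12 * z + 4) e); [lia|].
destruct (Z.leb_spec 1 z); [|destruct (Z.leb_spec 2 z); [lia|discriminate]].
destruct (three_term_test s qs (e + 12 * z - 8)); [left; auto|].
destruct (Z.leb_spec 2 z); [right; auto|discriminate].
Qed.

Lemma represented_small n : 0 <= n < 3000000 -> represented n.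
Proof.
intros Hn.
(* [4 penta 709] exceeds 3000000, so [z <= 708] and the remainder stays below [12 * 708 + 4 = 8500],
   within the range of [cover_test]. *)
assert (Hz : exists z, 0 <= z < 709 /\ 4 * penta z <= n < 4 * penta (z + 1)).
{ assert (Hk : forall k : nat, n < 4 * penta (Z.of_nat k) ->
    exists z, 0 <= z < Z.of_nat k /\ 4 * penta z <= n < 4 * penta (z + 1)).
  { induction k as [|k IH]; intros H; [unfold penta in H; simpl in H; lia|].
    destruct (Z_lt_ge_dec n (4 * penta (Z.of_nat k))) as [H1|H1].
    - destruct (IH H1) as (z & Hz & Hz'); exists z; lia.
    - exists (Z.of_nat k); replace (Z.of_nat k + 1) with (Z.of_nat (S k)) by lia; lia. }
  apply (Hk 709%N); replace (4 * penta (Z.of_nat 709)) with 3014668 by (vm_compute; reflexivity); lia. }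
destruct Hz as (z & Hz & Hnz).
pose proof (two_penta z) as Ez; pose proof (two_penta (z + 1)) as Ez1.
pose proof (two_penta (z - 1)) as Ezm; pose proof (two_penta (z - 2)) as Ezm2.
assert (Hr : 0 <= n - 4 * penta z < 12 * z + 4) by lia.
assert (Hrep : forall d r, 0 <= z - d -> n - 4 * penta (z - d) = r ->
  three_term_test two_term_set three_penta r = true -> represented n).
{ intros d r Hd E H; destruct (three_term_test_sound _ H) as (w & x & y & Hw & Hx & Hy & E').
  exists w, x, y, (z - d); repeat split; auto; lia. }
destruct (cover_test_sound _ _ (n - 4 * penta z) cover_test_true) as [A|A]; [lia| |].
{ apply (Hrep 0 (n - 4 * penta z)); auto; [lia|]; rewrite Z.sub_0_r; reflexivity. }
destruct (exceptions_test_sound _ _ z _ exceptions_test_true ltac:(lia) A) as [[B1 B2]|[B1 B2]]; [lia| |].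
- apply (Hrep 1 (n - 4 * penta z + 12 * z - 8)); auto; lia.
- apply (Hrep 2 (n - 4 * penta z + 24 * z - 28)); auto; lia.
Qed.

(** * Return to natural numbers *)

Lemma p5_penta k : Z.of_nat (p5 k) = penta (Z.of_nat k).
Proof.
assert (Hhalf : forall n, Z.of_nat n./2 = Z.of_nat n / 2).
{ intros n; pose proof (odd_double_half n) as E; rewrite -addnn in E.
  change (Nat.add (nat_of_bool (odd n)) (Nat.add n./2 n./2) = n) in E.
  destruct (odd n); simpl nat_of_bool in E; lia. }
unfold p5; rewrite Hhalf /penta; f_equal.
change (Z.of_nat (Nat.mul k (Nat.sub (Nat.mul 3 k) 1)) = Z.of_nat k * (3 * Z.of_nat k - 1)).
rewrite Nat2Z.inj_mul; destruct k as [|k]; [reflexivity|f_equal; lia].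
Qed.

Local Close Scope Z_scope.

Theorem theorem1p2 : forall n : nat,
  exists w x y z : nat, n = p5 w + 2 * p5 x + 3 * p5 y + 4 * p5 z.
Proof.
intros n.
assert (H : represented (Z.of_nat n)).
{ destruct (Z_lt_ge_dec (Z.of_nat n) 3000000%Z); [apply represented_small|apply represented_large]; lia. }
destruct H as (w & x & y & z & Hw & Hx & Hy & Hz & E).
exists (Z.to_nat w), (Z.to_nat x), (Z.to_nat y), (Z.to_nat z).
apply Nat2Z.inj.
rewrite E -{1}(Z2Nat.id w Hw) -{1}(Z2Nat.id x Hx) -{1}(Z2Nat.id y Hy) -{1}(Z2Nat.id z Hz) -!p5_penta.
change ((Z.of_nat (p5 (Z.to_nat w)) + 2 * Z.of_nat (p5 (Z.to_nat x)) + 3 * Z.of_nat (p5 (Z.to_nat y))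
  + 4 * Z.of_nat (p5 (Z.to_nat z)))%Z = Z.of_nat (Nat.add (Nat.add (Nat.add (p5 (Z.to_nat w))
  (Nat.mul 2 (p5 (Z.to_nat x)))) (Nat.mul 3 (p5 (Z.to_nat y)))) (Nat.mul 4 (p5 (Z.to_nat z))))).
lia.
Qed.
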